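(* Let $\alpha\in(0,1)$, let $J=[0,T]$ for some $T>0$ or $J=[0,\infty)$, and let $f:J\times\mathbb{R}\to\mathbb{R}$ be continuous and satisfy $|f(t,x)-f(t,y)|\le L(t)|x-y|$ for all $t\in J$, $x,y\in\mathbb{R}$, where $L:J\to[0,\infty)$ is continuous. Then for any two solutions $x_1(\cdot),x_2(\cdot)$ of ${}^{C}D^\alpha_{0+}x(t)=f(t,x(t))$ on $J$ and any $t\in J$, $$|x_2(t)-x_1(t)|\ \ge\ |x_2(0)-x_1(0)|\,E_\alpha\Big(-\big(\max_{0\le\tau\le t}L(\tau)\big)t^\alpha\Big).$$
   Context: ${}^{C}D^\alpha_{0+}$ is the Caputo fractional derivative of order $\alpha$; a solution is a continuous $x:J\to\mathbb{R}$ with $x(t)=x(0)+\frac{1}{\Gamma(\alpha)}\int_0^t(t-\tau)^{\alpha-1}f(\tau,x(\tau))\,d\tau$ for all $t\in J$. $E_\alpha(z)=\sum_{k=0}^\infty\frac{z^k}{\Gamma(\alpha k+1)}$ is the Mittag-Leffler function. *)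

(* Defs.v *)
From HB Require Import structures.
From mathcomp Require Import all_boot all_order all_algebra.
From mathcomp Require Import all_classical all_reals all_analysis.
Set Implicit Arguments. Unset Strict Implicit. Unset Printing Implicit Defensive.
Import Order.TTheory GRing.Theory Num.Theory.
Import numFieldNormedType.Exports.
Local Open Scope classical_set_scope.
Local Open Scope ring_scope.

Definition Gamma {R : realType} (s : R) : R :=
  Rintegral (@lebesgue_measure R) `]0, +oo[ (fun x => x `^ (s - 1) * expR (- x)).

Definition mittag_leffler {R : realType} (a z : R) : R :=
  limn (fun n => \sum_(0 <= k < n) (z ^+ k / Gamma (a * k%:R + 1))).

(* x is a solution on J of the Caputo equation  ^C D^a_{0+} x(t) = f(t, x(t)):
   x continuous on J and the integral (Volterra) form holds for all t in J. *)
Definition caputo_solution {R : realType} (a : R) (J : set R)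
    (f : R -> R -> R) (x : R -> R) : Prop :=
  {within J, continuous x} /\
  forall t, J t ->
    x t = x 0 + (Gamma a)^-1 *
      Rintegral (@lebesgue_measure R) `[0, t]
        (fun tau => (t - tau) `^ (a - 1) * f tau (x tau)).

(* Main.v *)
Require Import Defs.
From HB Require Import structures.
From mathcomp Require Import all_boot all_order all_algebra.
From mathcomp Require Import all_classical all_reals all_analysis.
From mathcomp Require Import measurable_realfun ring lra.
Set Implicit Arguments.
Unset Strict Implicit.
Unset Printing Implicit Defensive.
Import Order.TTheory GRing.Theory Num.Theory.
Import numFieldNormedType.Exports.
Local Open Scope classical_set_scope.
Local Open Scope ring_scope.

(** The difference z of two solutions satisfies z = z(0) + I^a g with
    |g| <= M |z|, while u(t) = E_a(- M t^a) satisfies u = 1 - M I^a u.  As long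
    as z >= 0, the function y = z - z(0) u is of the form I^a phi with phi >= 0
    wherever y < 0, so z >= z(0) u follows from a minimum principle: if
    y = y0 + I^a phi with y0 >= 0 and phi >= 0 wherever y < 0, then y >= 0.

    To prove it, suppose that y attains a negative minimum at t1 and pick
    t0 < t1 with y < 0 on [t0, t1].  The kernel
    k(t, s) = (t - s)^(a-1) / Gamma(a) can be swept onto [0, t0]: for s < t0,
      k(t1, s) = int_s^t0 k(r, s) P(r) dr  with  P >= 0,
      int_0^t0 P <= (t0 / t1)^(1-a) < 1.
    So the part of I^a phi(t1) that comes from [0, t0] is the integral against P
    of the earlier values I^a phi(r) >= y(t1) - y0, and the part that comes from
    [t0, t1] is nonnegative; hence y(t1) - y0 > y(t1) - y0.

    The same principle shows that E_a is nonnegative, and nondecreasing on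
    x <= 0.  If z vanishes for the first time at t1 <= T, then
    E_a(- M t1^a) <= 0, hence E_a(- M T^a) <= 0 and the bound at T is
    trivial. *)

(** * Substitution in improper integrals *)

Section segment_exhaustion.
Context {R : realType}.
Implicit Types (A : set R) (u v : nat -> R) (a b x : R).

Definition segment_exhaustion A u v :=
  [/\ nonincreasing_seq u, nondecreasing_seq v, forall n, u n <= v n &
      A = \bigcup_n `[u n, v n]%classic].

Lemma segment_exhaustion_subset A u v n :
  segment_exhaustion A u v -> `[u n, v n] `<=` A.
Proof. by move=> [_ _ _ ->] x; exists n. Qed.

Lemma nondecreasing_segments u v :
  nonincreasing_seq u -> nondecreasing_seq v ->
  nondecreasing_seq (fun n => `[u n, v n]%classic).
Proof.
move=> ninc_u nd_v m n mn; rewrite subsetEset.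
by apply: subset_itv; rewrite bnd_simp; [exact: ninc_u|exact: nd_v].
Qed.

Lemma exists_natr_gt x : exists n, x < n.+1%:R.
Proof.
exists (Num.truncn x); apply: (lt_le_trans (truncnS_gt x)).
by rewrite ler_nat.
Qed.

Lemma segment_exhaustion_oo a b : a < b ->
  segment_exhaustion `]a, b[ (fun n => a + (b - a) / n.+2%:R)
                             (fun n => b - (b - a) / n.+2%:R).
Proof.
move=> ab; have ba : 0 < b - a by rewrite subr_gt0.
have ninc m n : (m <= n)%N -> (b - a) / n.+2%:R <= (b - a) / m.+2%:R.
  by move=> mn; rewrite ler_pM2l// lef_pV2 ?posrE// ler_nat !ltnS.
split.
- by move=> m n mn; rewrite lerD2l; exact: ninc.
- by move=> m n mn; rewrite lerD2l lerN2; exact: ninc.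
- move=> n; have := ninc 0%N n isT; rewrite -/(2%:R : R).
  by set e := _ / n.+2%:R => ?; lra.
- apply/seteqP; split => [x|x [n _]] /=; rewrite !in_itv/=.
  + move=> /andP[ax xb]; pose e := Num.min (x - a) (b - x).
    have e0 : 0 < e by rewrite lt_min !subr_gt0 ax xb.
    have [n /ltW ben] := exists_natr_gt ((b - a) / e).
    have : (b - a) / n.+2%:R <= e.
      rewrite ler_pdivrMr// mulrC -ler_pdivrMr// (le_trans ben)//.
      by rewrite ler_nat.
    move=> dn; exists n => //=; move: dn; rewrite le_min in_itv/=.
    by set d := _ / n.+2%:R => /andP[? ?]; apply/andP; split; lra.
  + have : 0 < (b - a) / n.+2%:R by rewrite divr_gt0.
    by set d := _ / n.+2%:R => ? /andP[? ?]; apply/andP; split; lra.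
Qed.

Lemma segment_exhaustion_oy :
  segment_exhaustion `]0, +oo[ (fun n => n.+1%:R^-1) (fun n => n.+1%:R).
Proof.
split.
- by move=> m n mn; rewrite lef_pV2 ?posrE// ler_nat.
- by move=> m n mn; rewrite ler_nat.
- by move=> n; apply: (@le_trans _ _ 1); rewrite ?invf_le1 ?ler1n.
- apply/seteqP; split => [x|x [n _]] /=; rewrite !in_itv/= ?andbT.
  + move=> x0; have [n xn] := exists_natr_gt (Num.max x x^-1).
    move: xn; rewrite gt_max => /andP[xn xVn].
    exists n => //=; rewrite in_itv/= (ltW xn) andbT.
    by rewrite -[leRHS]invrK lef_pV2 ?posrE// ?invr_gt0// ltW.
  + by move=> /andP[+ _]; apply: lt_le_trans; rewrite invr_gt0.
Qed.

End segment_exhaustion.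

Section ge0_integration_by_substitution.
Context {R : realType}.
Notation mu := (@lebesgue_measure R).
Variables (F F' G : R -> R) (A : set R).
Hypothesis A_open : open A.
Hypothesis F_is_derive : forall x, A x -> is_derive x (1 : R) F (F' x).
Hypothesis F'_continuous : forall x, A x -> {for x, continuous F'}.
Hypothesis F'_gt0 : forall x, A x -> 0 < F' x.
Hypothesis G_continuous : forall y, (F @` A) y -> {for y, continuous G}.
Hypothesis G_ge0 : forall y, (F @` A) y -> 0 <= G y.

Let F_continuous x : A x -> {for x, continuous F}.
Proof.
by move=> /F_is_derive[dF _]; exact/differentiable_continuous/derivable1_diffP.
Qed.

Let derive1F x : A x -> derive1 F x = F' x.
Proof. by move=> Ax; rewrite derive1E; have [_ ->] := F_is_derive Ax. Qed.

Let derive1F_continuous x : A x -> {for x, continuous (derive1 F)}.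
Proof.
move=> Ax; rewrite /prop_for /continuous_at derive1F//.
apply: cvg_trans (F'_continuous Ax); apply: near_eq_cvg.
by apply: filterS (open_nbhs_nbhs (conj A_open Ax)) => y Ay; rewrite derive1F.
Qed.

Section segment.
Variables u v : R.
Hypotheses (uv : u <= v) (uvA : `[u, v] `<=` A).

Let F_within : {within `[u, v], continuous F}.
Proof.
by apply: continuous_in_subspaceT => x /[!inE] /uvA; exact: F_continuous.
Qed.

Let F_increasing : {in `[u, v] &, {homo F : x y / x < y}}.
Proof.
apply: gtr0_derive1_lt => // x /subset_itv_oo_cc/uvA Ax.
  by case: (F_is_derive Ax).
by rewrite derive1F// F'_gt0.
Qed.

Lemma image_segment_derive_gt0 : F @` `[u, v] = `[F u, F v]%classic.
Proof.
have F_le : {in `[u, v] &, {homo F : x y / x <= y}} by exact: ltW_homo_in.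
have [u_in v_in] : u \in `[u, v] /\ v \in `[u, v] by rewrite !in_itv/= !lexx uv.
apply/seteqP; split => [_ [x /= xuv <-]|]; last first.
  by apply: segment_continuous_le_surjective => //; exact: F_le.
by rewrite in_itv/= !F_le// ?(itvP xuv).
Qed.

Lemma integration_by_substitution_segment :
  (\int[mu]_(y in `[F u, F v]) (G y)%:E =
   \int[mu]_(x in `[u, v]) (G (F x) * F' x)%:E)%E.
Proof.
have [Au Av] : A u /\ A v by split; apply: uvA; rewrite /= in_itv/= lexx uv.
have ooA x : x \in `]u, v[ -> A x by move=> /subset_itv_oo_cc/uvA.
rewrite integration_by_substitution_increasing//.
- by apply: eq_integral => x /[!inE]/= /uvA Ax; rewrite !fctE derive1F.
- by move=> x /ooA; exact: derive1F_continuous.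
- apply/cvg_ex; exists (derive1 F u); apply: cvg_at_right_filter.
  exact: derive1F_continuous.
- apply/cvg_ex; exists (derive1 F v); apply: cvg_at_left_filter.
  exact: derive1F_continuous.
- split => [x /ooA/F_is_derive[]//| |].
    by apply: cvg_at_right_filter; exact: F_continuous.
  by apply: cvg_at_left_filter; exact: F_continuous.
- apply: continuous_in_subspaceT => y /[!inE].
  by rewrite -image_segment_derive_gt0 => /(image_subset F uvA)/G_continuous.
Qed.

End segment.

Lemma ge0_integration_by_substitution (u v : nat -> R) :
  segment_exhaustion A u v ->
  (\int[mu]_(y in F @` A) (G y)%:E = \int[mu]_(x in A) (G (F x) * F' x)%:E)%E.
Proof.
move=> Auv; have [ninc_u nd_v uv AE] := Auv.
have uvA n := @segment_exhaustion_subset _ _ _ _ n Auv.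
have FE n := image_segment_derive_gt0 (uv n) (@uvA n).
have ndA := nondecreasing_segments ninc_u nd_v.
have FAE : F @` A = \bigcup_n `[F (u n), F (v n)]%classic.
  by rewrite [in LHS]AE image_bigcup; apply: eq_bigcupr => n _.
have ndFA : nondecreasing_seq (fun n => `[F (u n), F (v n)]%classic).
  move=> m n /ndA; rewrite !subsetEset -!FE; exact: image_subset.
have mFA n : measurable_fun `[F (u n), F (v n)] (EFin \o G).
  apply/measurable_EFinP; apply: subspace_continuous_measurable_fun => //.
  apply: continuous_in_subspaceT => y /[!inE].
  by rewrite -FE => /(image_subset F (@uvA n))/G_continuous.
have mA n : measurable_fun `[u n, v n] (EFin \o (fun x => G (F x) * F' x)).
  apply/measurable_EFinP; apply: subspace_continuous_measurable_fun => //.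
  apply: continuous_in_subspaceT => x /[!inE] /uvA Ax.
  apply: continuousM; last exact: F'_continuous.
  apply: (@continuous_comp _ _ _ F G); first exact: F_continuous.
  by apply: G_continuous; exists x.
have cvgFA : (\int[mu]_(y in `[F (u n), F (v n)]) (G y)%:E @[n --> \oo] -->
    \int[mu]_(y in F @` A) (G y)%:E)%E.
  rewrite FAE; apply: ge0_nondecreasing_set_cvg_integral => // n y.
  by rewrite -FE => /(image_subset F (@uvA n))/G_ge0; rewrite lee_fin.
have cvgA : (\int[mu]_(x in `[u n, v n]) (G (F x) * F' x)%:E @[n --> \oo] -->
    \int[mu]_(x in A) (G (F x) * F' x)%:E)%E.
  rewrite [in X in _ --> X]AE; apply: ge0_nondecreasing_set_cvg_integral => //.
  move=> n x /uvA Ax; rewrite lee_fin mulr_ge0 ?(ltW (F'_gt0 Ax))//.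
  by apply: G_ge0; exists x.
move: cvgFA; under eq_fun do rewrite integration_by_substitution_segment//.
by move=> /cvg_lim <- //; apply/cvg_lim.
Qed.

End ge0_integration_by_substitution.

Section real_integrals.
Context {R : realType}.
Notation mu := (@lebesgue_measure R).

Lemma integral_derive_gt0 (F F' : R -> R) (A : set R) (u v : nat -> R) :
  open A -> segment_exhaustion A u v ->
  (forall x, A x -> is_derive x (1 : R) F (F' x)) ->
  (forall x, A x -> {for x, continuous F'}) ->
  (forall x, A x -> 0 < F' x) ->
  measurable (F @` A) ->
  (\int[mu]_(x in A) (F' x)%:E = mu (F @` A))%E.
Proof.
move=> A_open Auv F_is_derive F'_continuous F'_gt0 mFA.
transitivity (\int[mu]_(y in F @` A) (cst 1 y)%:E)%E; last first.
  by rewrite (integral_cst mu _ 1%:E)// mul1e.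
rewrite (ge0_integration_by_substitution A_open F_is_derive _ _ _ _ Auv)//.
- by apply: eq_integral => x _; rewrite mul1r.
- by move=> y _; exact: cst_continuous.
Qed.

Lemma ge0_integral_EFinZl (D : set R) (f : R -> R) (k : R) :
  measurable D -> measurable_fun D f -> (forall x, D x -> 0 <= f x) -> 0 <= k ->
  (\int[mu]_(x in D) (k * f x)%:E = k%:E * \int[mu]_(x in D) (f x)%:E)%E.
Proof.
move=> mD mf f0 k0; under eq_integral do rewrite EFinM.
by rewrite ge0_integralZl_EFin//; exact/measurable_EFinP.
Qed.

Lemma EFin_Rintegral_itvoo (a b : R) (f : R -> R) :
  mu.-integrable `[a, b] (EFin \o f) ->
  ((Rintegral mu `[a, b] f)%:E = \int[mu]_(x in `]a, b[) (f x)%:E)%E.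
Proof.
move=> intf; rewrite /Rintegral fineK ?integrable_fin_num//.
apply: integral_itv_bndoo; apply: measurable_funS (measurable_int _ intf) => //.
exact: subset_itv_oo_cc.
Qed.

Definition open_triangle (a : R) (b : itv_bound R) : set (R * R) :=
  [set z | [/\ a < z.1, z.1 < z.2 & z.2 \in Interval -oo%O b]].

Lemma measurable_open_triangle a b : measurable (open_triangle a b).
Proof.
have -> : open_triangle a b = fst @^-1` `]a, +oo[ `&`
    ((fun z : R * R => z.2 - z.1) @^-1` `]0, +oo[ `&`
     snd @^-1` [set` Interval -oo%O b]).
  by apply/seteqP; split => -[x y]; rewrite /open_triangle/= !in_itv/= !andbT
    subr_gt0 => -[? []].
apply: measurableI; last apply: measurableI;
  rewrite -[X in measurable X]setTI.
- exact: measurable_fst.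
- exact: (measurable_funB measurable_snd measurable_fst).
- exact: measurable_snd.
Qed.

Lemma measurable_fst_open_triangle (a : R) b (f : R -> R) :
  measurable_fun [set` Interval (BRight a) b] f ->
  measurable_fun (open_triangle a b) (fun z => f z.1).
Proof.
move=> mf; apply: measurable_comp mf _; first exact: measurable_itv.
  move=> _ [[x y] [/= ax xy + ] <-]; rewrite /= !itv_boundlr/= bnd_simp.
  by rewrite ax; apply: le_trans; rewrite bnd_simp ltW.
by apply: measurable_funTS; exact: measurable_fst.
Qed.

Section tonelli_triangle.
Variables (g : R * R -> \bar R) (a : R) (b : itv_bound R).
Local Notation T := (open_triangle a b).
Hypothesis mg : measurable_fun T g.
Hypothesis g0 : forall z, T z -> (0 <= g z)%E.

Let mgT : measurable_fun setT (g \_ T).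
Proof. exact/(measurable_restrictT _ (measurable_open_triangle a b)). Qed.

Let gT0 z : (0 <= (g \_ T) z)%E.
Proof. exact: erestrict_ge0. Qed.

Let mem_T x y : ((x, y) \in T) = [&& a < x, x < y & y \in Interval -oo%O b].
Proof. by apply/idP/idP; rewrite inE => /and3P. Qed.

Let mem_itv x y :
  x \in Interval (BRight y) b = (y < x) && (x \in Interval -oo%O b).
Proof. by rewrite !itv_boundlr/= bnd_simp. Qed.

Let integral_xslice x : (\int[mu]_y (g \_ T) (x, y) =
  ((fun x => \int[mu]_(y in [set` Interval (BRight x) b]) g (x, y)) \_
    [set` Interval (BRight a) b]) x)%E.
Proof.
rewrite patchE mem_setE mem_itv; case: ifPn => [/andP[ax xb]|xb].
  rewrite [RHS]integral_mkcond; apply: eq_integral => y _.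
  by rewrite !patchE mem_T ax/= mem_setE mem_itv.
rewrite integral0_eq// => y _; rewrite patchE mem_T.
case: ifPn => // /and3P[ax xy yb]; move: xb; rewrite ax /=.
move: yb; rewrite !itv_boundlr/= => yb /negP[]; apply: le_trans yb.
by rewrite bnd_simp ltW.
Qed.

Let integral_yslice y : (\int[mu]_x (g \_ T) (x, y) =
  ((fun y => \int[mu]_(x in `]a, y[) g (x, y)) \_
    [set` Interval (BRight a) b]) y)%E.
Proof.
rewrite patchE mem_setE mem_itv; case: ifPn => [/andP[ay yb]|yb].
  rewrite [RHS]integral_mkcond; apply: eq_integral => x _.
  by rewrite !patchE mem_T yb andbT mem_setE in_itv.
rewrite integral0_eq// => x _; rewrite patchE mem_T.
by case: ifPn => // /and3P[ax xy yb']; rewrite (lt_trans ax xy) yb' in yb.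
Qed.

Lemma tonelli_triangle :
  (\int[mu]_(x in [set` Interval (BRight a) b])
     \int[mu]_(y in [set` Interval (BRight x) b]) g (x, y) =
   \int[mu]_(y in [set` Interval (BRight a) b])
     \int[mu]_(x in `]a, y[) g (x, y))%E.
Proof.
rewrite [LHS]integral_mkcond [RHS]integral_mkcond.
under [LHS]eq_integral do rewrite -integral_xslice.
under [RHS]eq_integral do rewrite -integral_yslice.
exact: (@fubini_tonelli _ _ (measurableTypeR R) (measurableTypeR R) R mu mu).
Qed.

Lemma measurable_integral_triangle :
  measurable_fun [set` Interval (BRight a) b]
    (fun y => \int[mu]_(x in `]a, y[) g (x, y))%E.
Proof.
apply/(measurable_restrictT _ (measurable_itv _)).
rewrite [X in measurable_fun _ X](_ : _ =
  fun y => \int[mu]_x (g \_ T) (x, y))%E; last first.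
  by apply/funext => y; rewrite integral_yslice.
exact: (@measurable_fun_fubini_tonelli_G _ _ (measurableTypeR R)
  (measurableTypeR R) R mu).
Qed.

End tonelli_triangle.

End real_integrals.

(** * The Gamma and Beta integrals *)

Section powR.
Context {R : realType}.
Implicit Types (p s c t x : R) (D : set R).

Lemma continuous_powR p x : 0 < x -> {for x, continuous (@powR R ^~ p)}.
Proof.
move=> x0; apply: differentiable_continuous; apply/derivable1_diffP.
by apply: derivable_powR; rewrite in_itv/= x0.
Qed.

Lemma measurable_fun_powR d (T : measurableType d) (D : set T) (f : T -> R) p :
  measurable_fun D f -> measurable_fun D (fun z => f z `^ p).
Proof. by move=> mf; exact: (measurableT_comp (measurable_powR p) mf). Qed.

Lemma measurable_powR_subl p x D : measurable_fun D (fun y : R => (x - y) `^ p).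
Proof. by apply: measurable_fun_powR; exact: measurable_funB. Qed.

Lemma image_powR p t : 0 < p -> 0 < t ->
  (@powR R ^~ p) @` `]0, t[ = `]0, t `^ p[%classic.
Proof.
move=> p0 t0; apply/seteqP; split => [_ [x /= + <-]|y /=]; rewrite !in_itv/=.
  move=> /andP[x0 xt]; rewrite powR_gt0//=.
  by apply: gt0_ltr_powR; rewrite // nnegrE ltW.
move=> /andP[y0 ytp]; exists (y `^ p^-1); last first.
  by rewrite -powRrM mulVf ?gt_eqF// powRr1// ltW.
rewrite /= in_itv/= powR_gt0//= -[ltRHS]powRr1 ?(ltW t0)//.
rewrite -(@divff _ p) ?gt_eqF// powRrM.
by apply: gt0_ltr_powR; rewrite ?nnegrE ?invr_gt0 ?powR_ge0// ltW.
Qed.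

Lemma integral_powRB1 p t : 0 < p -> 0 < t ->
  (\int[@lebesgue_measure R]_(x in `]0%R, t[) (x `^ (p - 1))%:E =
   (t `^ p / p)%:E)%E.
Proof.
move=> p0 t0; have tp0 : 0 < t `^ p by rewrite powR_gt0.
have : (\int[lebesgue_measure]_(x in `]0%R, t[) (p * x `^ (p - 1))%:E =
    lebesgue_measure ((@powR R ^~ p) @` `]0%R, t[))%E.
  apply: (integral_derive_gt0 (itv_open _ _) (segment_exhaustion_oo t0)).
  - by move=> x /=; rewrite in_itv/= => /andP[x0 _]; exact: is_derive1_powR.
  - move=> x /=; rewrite in_itv/= => /andP[x0 _]; apply: continuousM.
      exact: cst_continuous.
    exact: continuous_powR.
  - by move=> x /=; rewrite in_itv/= => /andP[x0 _]; rewrite mulr_gt0 ?powR_gt0.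
  - by rewrite image_powR//; exact: measurable_itv.
rewrite image_powR// lebesgue_measure_itv/= lte_fin tp0 oppr0 adde0.
rewrite ge0_integral_EFinZl ?(ltW p0)//; last 2 first.
- by apply: measurable_funTS; exact: measurable_powR.
- by move=> x _; exact: powR_ge0.
move=> eq_tp; rewrite mulrC EFinM -eq_tp muleA -EFinM mulVf ?gt_eqF//.
by rewrite mul1e.
Qed.

Lemma powR_le_expR s c x : 0 < s -> 0 < c -> 0 < x ->
  x `^ s <= (s / c) `^ s * expR (c * x).
Proof.
move=> s0 c0 x0; have sc0 : 0 < s / c by rewrite divr_gt0.
have -> : x = s / c * (c * x / s) by field; rewrite !gt_eqF.
set y := c * x / s; have y0 : 0 < y by rewrite divr_gt0 ?mulr_gt0.
have -> : c * (s / c * y) = s * y by field; rewrite gt_eqF.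
rewrite powRM ?(ltW sc0) ?(ltW y0)// ler_pM2l ?powR_gt0//.
by rewrite /powR (gt_eqF y0) ler_expR ler_pM2l// ltW// ln_sublinear.
Qed.

End powR.

Section Gamma.
Context {R : realType}.
Notation mu := (@lebesgue_measure R).
Implicit Types (s c x : R) (D : set R).

Definition gamma_density s x : R := x `^ (s - 1) * expR (- x).

Lemma gamma_density_ge0 s x : 0 <= gamma_density s x.
Proof. by rewrite mulr_ge0 ?powR_ge0 ?expR_ge0. Qed.

Lemma measurable_gamma_density s D : measurable_fun D (gamma_density s).
Proof.
apply: measurable_funTS; apply: measurable_funM; first exact: measurable_powR.
by apply: measurableT_comp => //; exact: measurableT_comp.
Qed.

Lemma continuous_gamma_density s x :
  0 < x -> {for x, continuous (gamma_density s)}.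
Proof.
move=> x0; apply: continuousM; first exact: continuous_powR.
apply: (@continuous_comp _ _ _ -%R expR); last exact: continuous_expR.
exact: opp_continuous.
Qed.

Lemma image_onem_expRNM c : 0 < c ->
  (fun x : R => 1 - expR (- (c * x))) @` `]0, +oo[ = `]0, 1[%classic.
Proof.
move=> c0; apply/seteqP.
split => [_ [x /= + <-]|y /=]; rewrite !in_itv/= ?andbT.
  by move=> x0; rewrite subr_gt0 expR_lt1 oppr_lt0 mulr_gt0//= gtrBl expR_gt0.
move=> /andP[y0 y1]; exists (- (ln (1 - y) / c)).
  rewrite /= in_itv/= andbT oppr_gt0 pmulr_llt0 ?invr_gt0//.
  by rewrite ln_lt0// subr_gt0 y1 gtrBl.
by rewrite mulrN opprK mulrC divfK ?gt_eqF// lnK ?posrE ?subr_gt0// subKr.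
Qed.

Lemma integral_expRNM c : 0 < c ->
  (\int[mu]_(x in `]0%R, +oo[) (expR (- (c * x)))%:E = c^-1%:E)%E.
Proof.
move=> c0.
have cM : continuous (fun x : R => - (c * x)).
  move=> x; apply: continuousN; apply: continuousM => //.
  exact: cst_continuous.
have cexp : continuous (fun x : R => expR (- (c * x))).
  by move=> x; apply: continuous_comp; [exact: cM|exact: continuous_expR].
have : (\int[mu]_(x in `]0%R, +oo[) (c * expR (- (c * x)))%:E =
    mu ((fun x => 1 - expR (- (c * x)))%R @` `]0%R, +oo[))%E.
  apply: (integral_derive_gt0 (rray_open _) segment_exhaustion_oy).
  - move=> x _; have dM : is_derive x (1 : R) (fun z => - (c * z)) (- c).
      rewrite (_ : (fun _ => _) = (fun z => - c *: z)); last first.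
        by apply/funext => z; rewrite /GRing.scale/= mulNr.
      by apply: is_derive_eq; rewrite /GRing.scale/= mulr1.
    have dexp := is_derive1_comp (is_derive_expR _) dM.
    have d1B := is_deriveB (is_derive_cst (1 : R) x (1 : R)) dexp.
    by apply: (is_derive_eq d1B); ring.
  - by move=> x _; apply: continuousM; [exact: cst_continuous|exact: cexp].
  - by move=> x _; rewrite mulr_gt0 ?expR_gt0.
  - by rewrite image_onem_expRNM//; exact: measurable_itv.
rewrite image_onem_expRNM// lebesgue_measure_itv/= lte_fin ltr01 oppr0 adde0.
rewrite ge0_integral_EFinZl ?(ltW c0)//; last first.
  by apply: measurable_funTS; exact: continuous_measurable_fun.
move=> eq1; rewrite -[LHS]mul1e -[X in (X * _)%E](_ : (c^-1 * c)%:E = _).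
  by rewrite EFinM -muleA eq1 mule1.
by rewrite mulVf ?gt_eqF.
Qed.

Lemma measurable_EFin_gamma_density s D :
  measurable_fun D (fun x => (gamma_density s x)%:E).
Proof. by apply/measurable_EFinP; exact: measurable_gamma_density. Qed.

Lemma integral_gamma_density_01_lty s : 0 < s ->
  (\int[mu]_(x in `]0%R, 1%R[) (gamma_density s x)%:E < +oo)%E.
Proof.
move=> s0.
apply: (@le_lt_trans _ _ (\int[mu]_(x in `]0%R, 1%R[) (x `^ (s - 1))%:E)%E).
  apply: ge0_le_integral => //=.
  - by move=> x _; rewrite lee_fin gamma_density_ge0.
  - exact: measurable_EFin_gamma_density.
  - by apply/measurable_EFinP; apply: measurable_funTS; exact: measurable_powR.
  - move=> x; rewrite in_itv/= => /andP[x0 _].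
    by rewrite lee_fin ler_piMr ?powR_ge0// expR_le1 oppr_le0 ltW.
by rewrite integral_powRB1// ltry.
Qed.

Lemma integral_gamma_density_1y_lty s : 0 < s ->
  (\int[mu]_(x in `[1%R, +oo[) (gamma_density s x)%:E < +oo)%E.
Proof.
move=> s0; pose C := (s / 2^-1) `^ s.
have mexp D : measurable_fun D (fun x : R => C * expR (- (2^-1 * x))).
  apply: measurable_funTS; apply: measurable_funM => //.
  by apply: measurableT_comp => //; exact: measurableT_comp.
apply: (@le_lt_trans _ _
    (\int[mu]_(x in `]0%R, +oo[) (C * expR (- (2^-1 * x)))%:E)%E); last first.
  rewrite ge0_integral_EFinZl ?powR_ge0//.
    by rewrite integral_expRNM// -EFinM ltry.
  apply: measurable_funTS; apply: measurableT_comp => //.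
  exact: measurableT_comp.
apply: (@le_trans _ _
    (\int[mu]_(x in `[1%R, +oo[) (C * expR (- (2^-1 * x)))%:E)%E).
  apply: ge0_le_integral => //=.
  - by move=> x _; rewrite lee_fin gamma_density_ge0.
  - exact: measurable_EFin_gamma_density.
  - by apply/measurable_EFinP; exact: mexp.
  - move=> x; rewrite in_itv/= andbT => x1; have x0 := lt_le_trans ltr01 x1.
    have -> : - (2^-1 * x) = 2^-1 * x + - x by field.
    rewrite lee_fin expRD mulrA ler_wpM2r ?expR_ge0//.
    apply: le_trans (powR_le_expR s0 _ x0); last by rewrite invr_gt0.
    by apply: ler_powR => //; rewrite gerBl.
apply: ge0_subset_integral => //=.
- by apply/measurable_EFinP; exact: mexp.
- by move=> x _; rewrite lee_fin mulr_ge0 ?powR_ge0 ?expR_ge0.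
- by move=> x /=; rewrite !in_itv/= !andbT => /(lt_le_trans ltr01).
Qed.

Lemma integral_gamma_density_lty s : 0 < s ->
  (\int[mu]_(x in `]0%R, +oo[) (gamma_density s x)%:E < +oo)%E.
Proof.
move=> s0.
have -> : `]0%R, +oo[%classic = `]0, 1[%classic `|` `[1, +oo[%classic :> set R.
  by rewrite -itv_bndbnd_setU// bnd_simp.
rewrite ge0_integral_setU//=; last 3 first.
- exact: measurable_EFin_gamma_density.
- by move=> x _; rewrite lee_fin gamma_density_ge0.
- apply/disj_setPS => x [/=]; rewrite !in_itv/= andbT => /andP[_] x1.
  by rewrite leNgt x1.
by rewrite lte_add_pinfty ?integral_gamma_density_01_lty
  ?integral_gamma_density_1y_lty.
Qed.

Lemma EFin_Gamma s : 0 < s ->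
  (Gamma s)%:E = (\int[mu]_(x in `]0%R, +oo[) (gamma_density s x)%:E)%E.
Proof.
move=> s0; rewrite /Gamma /Rintegral fineK// ge0_fin_numE.
  exact: integral_gamma_density_lty.
by apply: integral_ge0 => x _; rewrite lee_fin gamma_density_ge0.
Qed.

Lemma Gamma1 : Gamma (1 : R) = 1.
Proof.
apply/EFin_inj; rewrite EFin_Gamma// -[in RHS]invr1 -integral_expRNM//.
by apply: eq_integral => x _; rewrite /gamma_density subrr powRr0 !mul1r.
Qed.

Lemma powR_le_Gamma s c : 0 < s -> 0 < c ->
  c `^ s * (expR (- (c + 1)) / (c + 1)) <= Gamma s.
Proof.
move=> s0 c0; rewrite -lee_fin EFin_Gamma//.
set K := c `^ s * _; have c1 : 0 < c + 1 by rewrite addr_gt0.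
apply: (@le_trans _ _
    (\int[mu]_(x in `]c, (c + 1)%R[) (gamma_density s x)%:E)%E); last first.
  apply: ge0_subset_integral => //=; first exact: measurable_EFin_gamma_density.
    by move=> x _; rewrite lee_fin gamma_density_ge0.
  by move=> x /=; rewrite !in_itv/= andbT => /andP[+ _]; exact: lt_trans.
have -> : K%:E = (\int[mu]_(x in `]c, (c + 1)%R[) cst K%:E x)%E.
  rewrite integral_cst//= lebesgue_measure_itv/= lte_fin ltrDl ltr01.
  by rewrite -EFinD addrAC subrr add0r mule1.
apply: ge0_le_integral => //=.
- by move=> x _; rewrite lee_fin mulr_ge0 ?powR_ge0// divr_ge0 ?expR_ge0// ltW.
- exact: measurable_EFin_gamma_density.
- move=> x; rewrite in_itv/= => /andP[cx xc]; rewrite lee_fin.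
  have x0 : 0 < x by exact: lt_trans cx.
  rewrite /gamma_density powRB ?(gt_eqF x0) ?implybT// powRr1 ?(ltW x0)//.
  rewrite -mulrA /K.
  apply: ler_pM; rewrite ?powR_ge0// ?divr_ge0 ?expR_ge0 ?(ltW c1)//.
    by apply: ge0_ler_powR; rewrite ?nnegrE ltW.
  rewrite mulrC; apply: ler_pM; rewrite ?invr_ge0 ?expR_ge0 ?(ltW c1)//.
    by rewrite lef_pV2 ?posrE// ltW.
  by rewrite ler_expR lerN2 ltW.
Qed.

Lemma Gamma_gt0 s : 0 < s -> 0 < Gamma s.
Proof.
move=> s0; apply: lt_le_trans (powR_le_Gamma s0 ltr01).
by rewrite mulr_gt0 ?powR_gt0// divr_gt0 ?expR_gt0// addr_gt0.
Qed.

End Gamma.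

Section Beta.
Context {R : realType}.
Notation mu := (@lebesgue_measure R).
Implicit Types (p q t x : R) (D : set R).

Definition beta_density p q t x : R := x `^ (p - 1) * (t - x) `^ (q - 1).

Lemma beta_density_ge0 p q t x : 0 <= beta_density p q t x.
Proof. by rewrite mulr_ge0 ?powR_ge0. Qed.

Lemma measurable_beta_density p q t D : measurable_fun D (beta_density p q t).
Proof.
apply: measurable_funM; first exact: measurable_fun_powR.
exact: measurable_powR_subl.
Qed.

Lemma continuous_beta_density p q t x :
  0 < x < t -> {for x, continuous (beta_density p q t)}.
Proof.
move=> /andP[x0 xt]; apply: continuousM; first exact: continuous_powR.
apply: (@continuous_comp _ _ _ (fun x => t - x) (fun x => x `^ (q - 1))).
  by apply: continuousB => //; exact: cst_continuous.
by apply: continuous_powR; rewrite subr_gt0.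
Qed.

Lemma image_mulr_itv01 t : 0 < t -> ( *%R t) @` `]0, 1[ = `]0, t[%classic.
Proof.
move=> t0; apply/seteqP; split => [_ [x /= + <-]|y /=]; rewrite !in_itv/=.
  by move=> /andP[x0 x1]; rewrite mulr_gt0//= gtr_pMr.
move=> /andP[y0 yt]; exists (y / t); last by rewrite mulrC divfK// gt_eqF.
by rewrite /= in_itv/= divr_gt0//= ltr_pdivrMr// mul1r.
Qed.

Lemma integral_beta_scale p q t : 0 < t ->
  (\int[mu]_(x in `]0%R, t[) (beta_density p q t x)%:E =
   (t `^ (p + q - 1))%:E *
   \int[mu]_(x in `]0%R, 1%R[) (beta_density p q 1 x)%:E)%E.
Proof.
move=> t0.
rewrite -image_mulr_itv01// (ge0_integration_by_substitution
  (itv_open _ _) (F' := cst t) _ _ _ _ _ (segment_exhaustion_oo ltr01)).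
- rewrite -ge0_integral_EFinZl ?powR_ge0//; last 2 first.
  + exact: measurable_beta_density.
  + by move=> x _; exact: beta_density_ge0.
  apply: eq_integral => x; rewrite inE/= in_itv/= => /andP[x0 x1].
  congr EFin; rewrite /beta_density.
  have -> : t - t * x = t * (1 - x) by ring.
  rewrite !powRM ?subr_ge0 ?(ltW t0) ?(ltW x0) ?(ltW x1)//.
  have -> : t `^ (p + q - 1) = t `^ (p - 1) * t `^ (q - 1) * t.
    rewrite -{4}(@powRr1 _ t) ?ltW// -!powRD ?(gt_eqF t0) ?implybT//.
    by congr (t `^ _); ring.
  by ring.
- move=> x _; rewrite (_ : *%R t = (fun z => t *: z))//.
  by apply: is_derive_eq; rewrite /GRing.scale/= mulr1.
- by move=> x _; exact: cst_continuous.
- by move=> x _.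
- move=> y; rewrite image_mulr_itv01//= in_itv/=.
  exact: continuous_beta_density.
- by move=> y _; exact: beta_density_ge0.
Qed.

Lemma image_addr_itvy x : (fun y => y + x) @` `]0, +oo[ = `]x, +oo[%classic.
Proof.
apply/seteqP; split => [_ [y /= + <-]|y /=]; rewrite !in_itv/= !andbT.
  by rewrite ltrDr.
by move=> xy; exists (y - x); rewrite ?subrK//= in_itv/= subr_gt0 xy.
Qed.

Lemma ge0_integral_itvy_shift (f : R -> R) x :
  (forall y, 0 < y -> {for y, continuous f}) -> (forall y, 0 < y -> 0 <= f y) ->
  (\int[mu]_(y in `]x, +oo[) (f (y - x))%:E =
   \int[mu]_(y in `]0%R, +oo[) (f y)%:E)%E.
Proof.
move=> cf f0.
rewrite -image_addr_itvy (ge0_integration_by_substitution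
  (rray_open _) (F' := cst 1) _ _ _ _ _ segment_exhaustion_oy).
- by apply: eq_integral => y _; rewrite addrK mulr1.
- by move=> y _; apply: is_derive_eq; rewrite addr0.
- by move=> y _; exact: cst_continuous.
- by move=> y _.
- move=> y; rewrite image_addr_itvy/= in_itv/= andbT => xy.
  apply: (@continuous_comp _ _ _ (fun y => y - x) f).
    by apply: continuousB => //; exact: cst_continuous.
  by apply: cf; rewrite subr_gt0.
- move=> y; rewrite image_addr_itvy/= in_itv/= andbT => xy.
  by rewrite f0// subr_gt0.
Qed.

Lemma Gamma_mul_integral p q : 0 < p -> 0 < q ->
  ((Gamma p * Gamma q)%:E =
   \int[mu]_(x in `]0%R, +oo[) \int[mu]_(y in `]x, +oo[)
     (beta_density p q y x * expR (- y))%:E)%E.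
Proof.
move=> p0 q0; rewrite mulrC EFinM (EFin_Gamma p0).
rewrite -ge0_integral_EFinZl ?ltW ?Gamma_gt0//; last 2 first.
- exact: measurable_gamma_density.
- by move=> x _; exact: gamma_density_ge0.
apply: eq_integral => x; rewrite inE/= in_itv/= andbT => x0.
rewrite mulrC EFinM (EFin_Gamma q0).
rewrite -(@ge0_integral_itvy_shift _ x); last 2 first.
- by move=> y y0; exact: continuous_gamma_density.
- by move=> y _; exact: gamma_density_ge0.
rewrite -ge0_integral_EFinZl ?gamma_density_ge0//; last 2 first.
- apply: measurable_funTS; apply: (measurableT_comp (f := gamma_density q)).
    exact: measurable_gamma_density.
  exact: measurable_funB.
- by move=> y _; exact: gamma_density_ge0.
apply: eq_integral => y _; congr EFin; rewrite /beta_density /gamma_density.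
have -> : - y = - x + - (y - x) by ring.
by rewrite expRD; ring.
Qed.

Lemma integral_beta01 p q : 0 < p -> 0 < q ->
  (\int[mu]_(x in `]0%R, 1%R[) (beta_density p q 1 x)%:E =
   (Gamma p * Gamma q / Gamma (p + q))%:E)%E.
Proof.
move=> p0 q0; set B := (X in X = _).
have pq0 : 0 < p + q by rewrite addr_gt0.
suff : (Gamma p * Gamma q)%:E = (B * (Gamma (p + q))%:E)%E.
  move=> e; rewrite EFinM e -muleA -EFinM divff ?mule1// gt_eqF//.
  exact: Gamma_gt0.
pose g (z : R * R) := (beta_density p q z.2 z.1 * expR (- z.2))%:E.
rewrite Gamma_mul_integral// (tonelli_triangle (g := g)); last 2 first.
- apply: measurable_funTS; apply/measurable_EFinP; apply: measurable_funM.
    apply: measurable_funM; apply: measurable_fun_powR.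
      exact: measurable_fst.
    exact: (measurable_funB measurable_snd measurable_fst).
  by apply: measurableT_comp => //; exact: measurableT_comp.
- by move=> z _; rewrite lee_fin mulr_ge0 ?beta_density_ge0 ?expR_ge0.
have B0 : (0 <= B)%E.
  by apply: integral_ge0 => x _; rewrite lee_fin beta_density_ge0.
rewrite (EFin_Gamma pq0) -ge0_integralZl//; last 2 first.
- exact: measurable_EFin_gamma_density.
- by move=> x _; rewrite lee_fin gamma_density_ge0.
apply: eq_integral => y; rewrite inE/= in_itv/= andbT => y0.
rewrite /gamma_density EFinM muleA [(B * _)%E]muleC -integral_beta_scale//.
rewrite muleC.
rewrite -ge0_integral_EFinZl ?expR_ge0//; last 2 first.
- exact: measurable_beta_density.
- by move=> x _; exact: beta_density_ge0.
by apply: eq_integral => x _; rewrite /g/= mulrC.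
Qed.

Lemma integral_beta p q t : 0 < p -> 0 < q -> 0 < t ->
  (\int[mu]_(x in `]0%R, t[) (beta_density p q t x)%:E =
   (t `^ (p + q - 1) * (Gamma p * Gamma q / Gamma (p + q)))%:E)%E.
Proof. by move=> p0 q0 t0; rewrite integral_beta_scale// integral_beta01. Qed.

End Beta.

(** * Functions continuous on a segment *)

Lemma within_continuous_graph (U V W : topologicalType) (J : set U)
    (f : U -> V -> W) (x : U -> V) :
  {within [set p : U * V | J p.1], continuous (fun p => f p.1 p.2)} ->
  {within J, continuous x} -> {within J, continuous (fun s => f s (x s))}.
Proof.
move=> /subspace_continuousP cf /subspace_continuousP cx.
apply/subspace_continuousP => s Js.
have graph : (fun r => (r, x r)) @ within J (nbhs s) --> (s, x s).
  apply: (@cvg_pair _ _ _ (within J (nbhs s)) (nbhs s) (nbhs (x s))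
    _ _ _ idfun x).
    exact: cvg_within.
  exact: cx.
apply: (@cvg_comp _ _ _ (fun r => (r, x r)) (fun p => f p.1 p.2) _ _ _ _
  (cf (s, x s) Js)) => P /= nP.
have J_near : \forall r \near within J (nbhs s), J r by exact: withinT.
have P_near : \forall r \near within J (nbhs s), J r -> P (r, x r).
  exact: (graph _ nP).
apply: (@filterS2 _ (within J (nbhs s)) _ _ _ _ _ J_near P_near).
by move=> r /[swap].
Qed.

Section within_continuity.
Context {R : realType}.
Implicit Types (f h : R -> R) (a c s t u v lambda : R).

Lemma within_continuous_itv_le f u t v : t <= v ->
  {within `[u, v], continuous f} -> {within `[u, t], continuous f}.
Proof. by move=> tv; apply: continuous_subspaceW; exact: subset_itvl. Qed.

Lemma within_continuousZ (A : set R) c f :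
  {within A, continuous f} -> {within A, continuous (fun s => c * f s)}.
Proof. by move=> cf s; apply: cvgM; [exact: cvg_cst|exact: cf]. Qed.

Lemma within_continuous_powR a : 0 < a ->
  {within `[0, +oo[, continuous (@powR R ^~ a)}.
Proof.
move=> a0; apply/continuous_within_itvcyP; split.
  by move=> x; rewrite in_itv/= andbT; exact: continuous_powR.
by rewrite powR0 ?gt_eqF//; exact: powR_cvg0.
Qed.

Lemma within_continuous_comp_powR a t lambda h : 0 < a -> continuous h ->
  {within `[0, t], continuous (fun s => h (lambda * s `^ a))}.
Proof.
move=> a0 ch.
apply: (@within_continuous_comp _ _ _ _ (fun s => lambda * s `^ a)).
  by move=> x _; exact: ch.
apply: within_continuousZ.
apply: continuous_subspaceW (within_continuous_powR a0).
exact: subset_itvl.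
Qed.

Lemma continuous_itv_bounded f u v : {within `[u, v], continuous f} ->
  exists B, forall s, u <= s <= v -> `|f s| <= B.
Proof.
move=> cf; have [uv|vu] := leP u v; last first.
  by exists 0 => s /andP[us sv]; move: vu; rewrite ltNge (le_trans us sv).
have cnorm : {within `[u, v], continuous (fun s => `|f s|)}.
  by move=> s; apply: cvg_norm; exact: cf.
have [c _ cB] := EVT_max uv cnorm.
by exists `|f c| => s st; apply: cB; rewrite in_itv.
Qed.

Lemma continuous_itv_le_sup f u v s : {within `[u, v], continuous f} ->
  u <= s <= v -> f s <= sup (f @` `[u, v]).
Proof.
move=> cf us; have [B fB] := continuous_itv_bounded cf.
apply: ub_le_sup; last by exists s => //=; rewrite in_itv.
by exists B => _ [r /= + <-]; rewrite in_itv/= => /fB/(le_trans (ler_norm _)).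
Qed.

Lemma continuous_itv_lt_left f u v s c :
  {within `[u, v], continuous f} -> u < s <= v -> f s < c ->
  exists2 t, u < t < s & forall r, t <= r <= s -> f r < c.
Proof.
move=> /subspace_continuousP cf /andP[us sv] fsc.
have suv : `[u, v]%classic s by rewrite /= in_itv/= (ltW us).
have /nbhs_ballP[e /= e0 fe] : \forall r \near s, `[u, v]%classic r -> f r < c.
  exact: (@cvgr_lt _ _ (within `[u, v] (nbhs s)) _ f _ (cf s suv) c fsc).
exists (Num.max ((u + s) / 2) (s - e / 2)).
  by rewrite lt_max gt_max !midf_lt// ltrBlDr ltrDl divr_gt0.
move=> r /andP[]; rewrite ge_max => /andP[ur er] rs; apply: fe.
  by rewrite /ball/= ger0_norm ?subr_ge0//; lra.
by rewrite /= in_itv/=; apply/andP; split; lra.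
Qed.

Lemma continuous_itv_first_zero f u v s :
  {within `[u, v], continuous f} -> 0 <= f u -> u <= s <= v -> f s <= 0 ->
  exists2 t, u <= t <= s & f t = 0 /\ forall r, u <= r <= t -> 0 <= f r.
Proof.
move=> cf fu0 suv fs0; have /andP[us sv] := suv.
pose N := `[u, v] `&` [set r | f r <= 0].
have memN r : u <= r <= v -> f r <= 0 -> r \in N.
  by move=> ruv fr; rewrite inE; split => //=; rewrite in_itv.
have cN : compact N.
  have /closed_subspaceP[V cV VE] :
      closed (f @^-1` [set y | y <= 0] : set (subspace `[u, v])).
    by move/continuous_closedP : cf; apply; exact: closed_le.
  have -> : N = `[u, v] `&` V by rewrite [RHS]setIC VE setIC.
  by apply: compact_closedI => //; exact: segment_compact.
have N0 : N !=set0 by exists s; exact/set_mem/memN.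
have cid : {within N, continuous (@idfun R)}.
  by apply: continuous_subspaceT => r; exact: cvg_id.
have [t /[!inE] -[/= + ft] tmin] := compact_EVT_min N0 cN cid.
rewrite in_itv/= => /andP[ut tv].
have pos r : u <= r -> r < t -> 0 < f r.
  move=> ur rt; rewrite ltNge; apply/negP => fr.
  have ruv : u <= r <= v by rewrite ur ltW// (lt_le_trans rt).
  by have := tmin _ (memN r ruv fr); rewrite leNgt rt.
have ft0 : f t = 0.
  have [|r] := IVT (v := 0) ut (within_continuous_itv_le tv cf).
    by rewrite ge_min le_max ft fu0 orbT.
  rewrite in_itv/= => /andP[ur]; rewrite le_eqVlt => /predU1P[->//|rt] fr.
  by have := pos _ ur rt; rewrite fr ltxx.
exists t; first by rewrite ut; exact/tmin/memN.
split => // r /andP[ur].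
by rewrite le_eqVlt => /predU1P[->|/(pos _ ur)/ltW//]; rewrite ft0.
Qed.

End within_continuity.

(** * Sweeping for the Abel kernel *)

Section moebius.
Context {R : realType}.
Variables s t0 t1 : R.
Hypotheses (st0 : s < t0) (t01 : t0 < t1).

Definition moebius r := (t1 - t0) / (t0 - s) * ((t1 - s) / (t1 - r) - 1).

Definition dmoebius r := (t1 - t0) * (t1 - s) / ((t0 - s) * (t1 - r) ^+ 2).

Let st0_gt0 : 0 < t0 - s. Proof. by rewrite subr_gt0. Qed.
Let t01_gt0 : 0 < t1 - t0. Proof. by rewrite subr_gt0. Qed.
Let st1_gt0 : 0 < t1 - s. Proof. by rewrite subr_gt0 (lt_trans st0). Qed.

Lemma moebiusE r : r < t1 ->
  moebius r = (t1 - t0) * (r - s) / ((t0 - s) * (t1 - r)).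
Proof.
by move=> rt1; rewrite /moebius; field; rewrite !gt_eqF// subr_gt0.
Qed.

Lemma onem_moebius r : r < t1 ->
  1 - moebius r = (t1 - s) * (t0 - r) / ((t0 - s) * (t1 - r)).
Proof.
by move=> rt1; rewrite /moebius; field; rewrite !gt_eqF// subr_gt0.
Qed.

Lemma is_derive_moebius r : r < t1 -> is_derive r (1 : R) moebius (dmoebius r).
Proof.
move=> rt1; have t1r0 : t1 - r != 0 by rewrite gt_eqF// subr_gt0.
have dB : is_derive r (1 : R) (fun r => t1 - r) (- 1).
  have d := is_deriveB (is_derive_cst t1 r (1 : R)) (is_derive_id r (1 : R)).
  by apply: (is_derive_eq d); rewrite sub0r.
have dV := @is_deriveV _ (fun r => t1 - r) _ _ _ t1r0 dB.
set c := (t1 - t0) / (t0 - s).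
have dZ := is_deriveZ (c * (t1 - s)) dV.
have dM := is_deriveB dZ (is_derive_cst c r (1 : R)).
rewrite (_ : moebius = (c * (t1 - s) \*: (fun r => (t1 - r)^-1)) - cst c).
  apply: (is_derive_eq dM).
  rewrite /GRing.scale/= subr0 mulrN1 opprK /c /dmoebius.
  by field; rewrite t1r0 gt_eqF.
by apply/funext => z; rewrite /moebius -/c !fctE/= /GRing.scale/=; ring.
Qed.

Lemma continuous_dmoebius r : r < t1 -> {for r, continuous dmoebius}.
Proof.
move=> rt1; have t1r0 : t1 - r != 0 by rewrite gt_eqF// subr_gt0.
apply: continuousM; first exact: cst_continuous.
apply: continuousV; first by rewrite mulf_neq0 ?expf_neq0// gt_eqF.
apply: continuousM; first exact: cst_continuous.
apply: (@continuous_comp _ _ _ (fun r => t1 - r) (fun x => x ^+ 2)).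
  by apply: continuousB => //; exact: cst_continuous.
exact: exprn_continuous.
Qed.

Lemma dmoebius_gt0 r : r < t1 -> 0 < dmoebius r.
Proof. by move=> rt1; rewrite divr_gt0 ?mulr_gt0 ?exprn_gt0// subr_gt0. Qed.

Lemma image_moebius : moebius @` `]s, t0[ = `]0, 1[%classic.
Proof.
apply/seteqP; split => [_ [r /= + <-]|y /=]; rewrite !in_itv/=.
  move=> /andP[sr rt0]; have rt1 := lt_trans rt0 t01.
  rewrite -[X in _ && X]subr_gt0 onem_moebius// moebiusE//.
  by rewrite !divr_gt0 ?mulr_gt0// subr_gt0.
move=> /andP[y0 y1]; pose d := (t1 - t0) + y * (t0 - s).
have d0 : 0 < d by rewrite addr_gt0// mulr_gt0.
have ltE : t1 - (s + y * (t0 - s) * (t1 - s) / d) = (t1 - t0) * (t1 - s) / d.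
  by rewrite /d; field; rewrite -/d gt_eqF.
have lt0E : t0 - (s + y * (t0 - s) * (t1 - s) / d) =
    (t1 - t0) * (t0 - s) * (1 - y) / d.
  by rewrite /d; field; rewrite -/d gt_eqF.
exists (s + y * (t0 - s) * (t1 - s) / d).
  rewrite /= in_itv/= ltrDl divr_gt0 ?mulr_gt0//= -subr_gt0 lt0E.
  by rewrite divr_gt0// !mulr_gt0// subr_gt0.
rewrite moebiusE; last by rewrite -subr_gt0 ltE divr_gt0// mulr_gt0.
by rewrite ltE /d; field; rewrite -/d !gt_eqF.
Qed.

Lemma beta_density_moebius a r : s < r < t0 ->
  beta_density a (1 - a) 1 (moebius r) * dmoebius r =
  (t1 - s) `^ (1 - a) * (t1 - t0) `^ a *
  ((r - s) `^ (a - 1) * ((t0 - r) `^ (- a) * (t1 - r) `^ (- 1))).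
Proof.
move=> /andP[sr rt0]; have rt1 := lt_trans rt0 t01.
rewrite /beta_density onem_moebius// moebiusE// /dmoebius.
have : 0 < r - s by rewrite subr_gt0.
have : 0 < t0 - r by rewrite subr_gt0.
have : 0 < t1 - r by rewrite subr_gt0.
move: st0_gt0 t01_gt0 st1_gt0.
(* Writing every base as an exponential makes the identity linear. *)
rewrite -!lnK_eq => /eqP<- /eqP<- /eqP<- /eqP<- /eqP<- /eqP<-.
rewrite -expRM_natr -!(expRD, expRN, expRM).
by congr expR; ring.
Qed.

End moebius.

Section sweep_kernel.
Context {R : realType}.
Notation mu := (@lebesgue_measure R).
Implicit Types (a s t r x y : R) (D : set R).

Definition abel_kernel a t s : R := (t - s) `^ (a - 1) / Gamma a.

(* The density of the balayage onto [0, t0] of the unit mass at t1; the constant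
   1 / (Gamma a * Gamma (1 - a)) is sin (pi * a) / pi. *)
Definition sweep_kernel a t0 t1 r : R :=
  (t1 - t0) `^ a / (Gamma a * Gamma (1 - a)) *
  ((t0 - r) `^ (- a) * (t1 - r) `^ (- 1)).

Lemma abel_kernel_ge0 a t s : 0 < a -> 0 <= abel_kernel a t s.
Proof. by move=> a0; rewrite divr_ge0 ?powR_ge0// ltW// Gamma_gt0. Qed.

Lemma measurable_abel_kernel a t D : measurable_fun D (abel_kernel a t).
Proof. by apply: measurable_funM => //; exact: measurable_powR_subl. Qed.

Lemma measurable_abel_kernel_left a s D :
  measurable_fun D (fun t => abel_kernel a t s).
Proof.
apply: measurable_funM => //.
by apply: measurable_fun_powR; exact: measurable_funB.
Qed.

Lemma measurable_abel_kernel2 a (D : set (R * R)) :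
  measurable_fun D (fun z => abel_kernel a z.2 z.1).
Proof.
apply: measurable_funTS; apply: measurable_funM => //.
apply: measurable_fun_powR.
exact: (measurable_funB measurable_snd measurable_fst).
Qed.

Lemma sweep_kernel_ge0 a t0 t1 r : 0 < a < 1 -> 0 <= sweep_kernel a t0 t1 r.
Proof.
move=> /andP[a0 a1]; rewrite mulr_ge0 ?divr_ge0 ?mulr_ge0 ?powR_ge0//.
  by rewrite ltW// Gamma_gt0.
by rewrite ltW// Gamma_gt0// subr_gt0.
Qed.

Lemma measurable_sweep_kernel a t0 t1 D :
  measurable_fun D (sweep_kernel a t0 t1).
Proof.
apply: measurable_funM => //.
by apply: measurable_funM; exact: measurable_powR_subl.
Qed.

Lemma integral_abel_sweep_kernel a s t0 t1 : 0 < a < 1 -> s < t0 -> t0 < t1 ->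
  (\int[mu]_(r in `]s, t0[) (abel_kernel a r s * sweep_kernel a t0 t1 r)%:E =
   (abel_kernel a t1 s)%:E)%E.
Proof.
move=> a01 st0 t01; have /andP[a0 a1] := a01; have st1 := lt_trans st0 t01.
have [Ga0 G1a0] : 0 < Gamma a /\ 0 < Gamma (1 - a).
  by split; apply: Gamma_gt0; rewrite ?subr_gt0.
have k0 : 0 < abel_kernel a t1 s by rewrite divr_gt0 ?powR_gt0 ?subr_gt0.
pose c := Gamma a * Gamma (1 - a) / abel_kernel a t1 s.
have c0 : 0 < c by rewrite divr_gt0// mulr_gt0.
set I := (X in X = _); suff : (Gamma a * Gamma (1 - a))%:E = (c%:E * I)%E.
  move=> eqI; rewrite -[LHS]mul1e -[X in (X%:E * _)%E](mulVf (lt0r_neq0 c0)).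
  by rewrite EFinM -muleA -eqI -EFinM invf_div divfK// mulf_neq0 ?gt_eqF.
have := integral_beta01 a0 (_ : 0 < 1 - a); rewrite subr_gt0 => /(_ a1).
rewrite (_ : a + (1 - a) = 1) ?Gamma1 ?divr1; last by ring.
move=> <-; rewrite -(image_moebius st0 t01).
have lt1 r : `]s, t0[%classic r -> r < t1.
  by rewrite /= in_itv/= => /andP[_ rt0]; exact: lt_trans t01.
rewrite (ge0_integration_by_substitution (itv_open _ _)
  (F' := dmoebius s t0 t1) _ _ _ _ _ (segment_exhaustion_oo st0)).
- rewrite /I -ge0_integral_EFinZl ?(ltW c0)//; last 2 first.
  + apply: measurable_funM; first exact: measurable_abel_kernel_left.
    exact: measurable_sweep_kernel.
  + by move=> r _; rewrite mulr_ge0 ?abel_kernel_ge0 ?sweep_kernel_ge0.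
  apply: eq_integral => r; rewrite inE/= in_itv/= => rst; congr EFin.
  have powR_inv : (t1 - s) `^ (1 - a) = ((t1 - s) `^ (a - 1))^-1.
    by rewrite -powRN opprB.
  rewrite beta_density_moebius// powR_inv /c /abel_kernel /sweep_kernel; field.
  by rewrite !gt_eqF ?powR_gt0 ?subr_gt0.
- by move=> r /lt1 rt1; exact: is_derive_moebius.
- by move=> r /lt1 rt1; exact: continuous_dmoebius.
- by move=> r /lt1 rt1; exact: dmoebius_gt0.
- move=> y; rewrite image_moebius//= in_itv/=.
  exact: continuous_beta_density.
- by move=> y _; exact: beta_density_ge0.
Qed.

End sweep_kernel.

Section sweeping.
Context {R : realType}.
Notation mu := (@lebesgue_measure R).
Variables a t0 t1 : R.
Hypotheses (a01 : 0 < a < 1) (t0_gt0 : 0 < t0) (t01 : t0 < t1).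
Implicit Types (s r N : R) (f g : R -> R).

Let a_gt0 : 0 < a. Proof. by case/andP: a01. Qed.

Let t1_gt0 : 0 < t1. Proof. exact: lt_trans t01. Qed.

Lemma integral_sweep_kernel_le :
  (\int[mu]_(r in `]0%R, t0[) (sweep_kernel a t0 t1 r)%:E <=
   ((t0 / t1) `^ (1 - a))%:E)%E.
Proof.
have Ga0 := Gamma_gt0 a_gt0.
pose c := t0 `^ (1 - a) * Gamma a.
have c0 : 0 <= c by rewrite mulr_ge0 ?powR_ge0 ?ltW.
have -> : ((t0 / t1) `^ (1 - a))%:E = (\int[mu]_(r in `]0%R, t0[)
    (c * (abel_kernel a r 0 * sweep_kernel a t0 t1 r))%:E)%E.
  rewrite ge0_integral_EFinZl//; last 2 first.
  - apply: measurable_funM; first exact: measurable_abel_kernel_left.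
    exact: measurable_sweep_kernel.
  - by move=> r _; rewrite mulr_ge0 ?abel_kernel_ge0 ?sweep_kernel_ge0.
  rewrite integral_abel_sweep_kernel// -EFinM /abel_kernel subr0 /c; congr EFin.
  rewrite powRM ?invr_ge0 ?(ltW t0_gt0) ?(ltW t1_gt0)//.
  rewrite -powR_inv1 ?(ltW t1_gt0)// -powRrM mulN1r opprB.
  by field; rewrite gt_eqF.
apply: ge0_le_integral => //=.
- by move=> r _; rewrite lee_fin sweep_kernel_ge0.
- by apply/measurable_EFinP; exact: measurable_sweep_kernel.
- apply/measurable_EFinP; apply: measurable_funM => //; apply: measurable_funM.
    exact: measurable_abel_kernel_left.
  exact: measurable_sweep_kernel.
- move=> r; rewrite in_itv/= => /andP[r0 rt0]; rewrite lee_fin mulrA.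
  rewrite ler_peMl ?sweep_kernel_ge0// /c /abel_kernel subr0.
  rewrite -mulrA [_ / Gamma a]mulrC mulVKf ?gt_eqF//.
  rewrite -[a - 1]opprB powRN ler_pdivlMr ?powR_gt0// mul1r.
  case/andP: a01 => _ a1.
  by apply: ge0_ler_powR; rewrite ?nnegrE ?subr_ge0 ltW.
Qed.

Lemma integral_abel_kernel_sweep f :
  measurable_fun `]0, t0[ f -> (forall s, 0 < s < t0 -> 0 <= f s) ->
  (\int[mu]_(s in `]0%R, t0[) (abel_kernel a t1 s * f s)%:E =
   \int[mu]_(r in `]0%R, t0[) ((sweep_kernel a t0 t1 r)%:E *
     \int[mu]_(s in `]0%R, r[) (abel_kernel a r s * f s)%:E))%E.
Proof.
move=> mf f0.
have f0' s : `]0, t0[%classic s -> 0 <= f s by rewrite /= in_itv/=; exact: f0.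
pose g (z : R * R) :=
  (f z.1 * (abel_kernel a z.2 z.1 * sweep_kernel a t0 t1 z.2))%:E.
transitivity (\int[mu]_(s in `]0%R, t0[) \int[mu]_(r in `]s, t0[) g (s, r))%E.
  apply: eq_integral => s; rewrite inE/= => st0.
  have := st0; rewrite in_itv/= => /andP[s0 lt_st0].
  rewrite /g/= ge0_integral_EFinZl ?f0'//; last 2 first.
  - apply: measurable_funM; first exact: measurable_abel_kernel_left.
    exact: measurable_sweep_kernel.
  - by move=> r _; rewrite mulr_ge0 ?abel_kernel_ge0 ?sweep_kernel_ge0.
  by rewrite integral_abel_sweep_kernel// -EFinM mulrC.
rewrite tonelli_triangle//; last 2 first.
- apply/measurable_EFinP; apply: measurable_funM.
    exact: measurable_fst_open_triangle.
  apply: measurable_funM; first exact: measurable_abel_kernel2.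
  apply: measurable_funTS.
  apply: (measurableT_comp (f := sweep_kernel a t0 t1)).
    exact: measurable_sweep_kernel.
  exact: measurable_snd.
- move=> z [z1 z12]; rewrite in_itv/= => z20; rewrite lee_fin.
  rewrite mulr_ge0 ?f0 ?z1 ?(lt_trans z12)//.
  by rewrite mulr_ge0 ?abel_kernel_ge0 ?sweep_kernel_ge0.
apply: eq_integral => r; rewrite inE/= in_itv/= => /andP[r0 rt0].
rewrite -ge0_integral_EFinZl ?sweep_kernel_ge0//; last 2 first.
- apply: measurable_funM; first exact: measurable_abel_kernel.
  apply: measurable_funS mf => //; apply: subset_itvl.
  by rewrite bnd_simp ltW.
- move=> s; rewrite /= in_itv/= => /andP[s0 sr].
  by rewrite mulr_ge0 ?abel_kernel_ge0// f0// s0 (lt_trans sr).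
by apply: eq_integral => s _; rewrite /g/=; congr EFin; ring.
Qed.

Lemma measurable_integral_abel_kernel f :
  measurable_fun `]0, t0[ f -> (forall s, 0 < s < t0 -> 0 <= f s) ->
  measurable_fun `]0, t0[
    (fun r => \int[mu]_(s in `]0%R, r[) (abel_kernel a r s * f s)%:E)%E.
Proof.
move=> mf f0; apply: (measurable_integral_triangle
  (g := fun z : R * R => (abel_kernel a z.2 z.1 * f z.1)%:E)).
- apply/measurable_EFinP; apply: measurable_funM.
    exact: measurable_abel_kernel2.
  exact: measurable_fst_open_triangle.
- move=> z [z1 z12]; rewrite in_itv/= => z20; rewrite lee_fin.
  by rewrite mulr_ge0 ?abel_kernel_ge0 ?f0 ?z1 ?(lt_trans z12).
Qed.

Lemma integral_abel_kernel_sweep_le f g N :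
  measurable_fun `]0, t0[ f -> (forall s, 0 < s < t0 -> 0 <= f s) ->
  measurable_fun `]0, t0[ g -> (forall s, 0 < s < t0 -> 0 <= g s) -> 0 <= N ->
  (forall r, (0 < r < t0)%R ->
    \int[mu]_(s in `]0%R, r[) (abel_kernel a r s * f s)%:E <=
    \int[mu]_(s in `]0%R, r[) (abel_kernel a r s * g s)%:E + N%:E)%E ->
  (\int[mu]_(s in `]0%R, t0[) (abel_kernel a t1 s * f s)%:E <=
   \int[mu]_(s in `]0%R, t0[) (abel_kernel a t1 s * g s)%:E +
   (N * (t0 / t1) `^ (1 - a))%:E)%E.
Proof.
move=> mf f0 mg g0 N0 leI; pose P r := (sweep_kernel a t0 t1 r)%:E.
pose I h r := (\int[mu]_(s in `]0%R, r[) (abel_kernel a r s * h s)%:E)%E.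
have P0 r : (0 <= P r)%E by rewrite lee_fin sweep_kernel_ge0.
have mP : measurable_fun `]0, t0[ P.
  by apply/measurable_EFinP; exact: measurable_sweep_kernel.
have I0 h : (forall s, 0 < s < t0 -> 0 <= h s) ->
    forall r, r < t0 -> (0 <= I h r)%E.
  move=> h0 r rt0; apply: integral_ge0 => s.
  rewrite /= in_itv/= => /andP[s0 sr].
  by rewrite lee_fin mulr_ge0 ?abel_kernel_ge0// h0// s0 (lt_trans sr).
rewrite !integral_abel_kernel_sweep// -/P.
apply: (@le_trans _ _ (\int[mu]_(r in `]0%R, t0[) (P r * (I g r + N%:E)))%E).
  apply: ge0_le_integral => //.
  - move=> r /=; rewrite in_itv/= => /andP[_ rt0].
    by apply: mule_ge0; [exact: P0|exact: (I0 _ f0)].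
  - by apply: emeasurable_funM => //; exact: measurable_integral_abel_kernel.
  - apply: emeasurable_funM => //; apply: emeasurable_funD => //.
    exact: measurable_integral_abel_kernel.
  - move=> r /=; rewrite in_itv/= => r0t0.
    by apply: lee_wpmul2l; [exact: P0|exact: leI].
have -> : (\int[mu]_(r in `]0%R, t0[) (P r * (I g r + N%:E)) =
    \int[mu]_(r in `]0%R, t0[) (P r * I g r) +
    N%:E * \int[mu]_(r in `]0%R, t0[) P r)%E.
  rewrite -ge0_integralZl// -ge0_integralD//.
  - apply: eq_integral => r; rewrite inE/= in_itv/= => /andP[_ rt0].
    by rewrite ge0_muleDr ?I0// [(N%:E * _)%E]muleC.
  - move=> r /=; rewrite in_itv/= => /andP[_ rt0].
    by apply: mule_ge0; [exact: P0|exact: (I0 _ g0)].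
  - by apply: emeasurable_funM => //; exact: measurable_integral_abel_kernel.
  - by move=> r _; rewrite mule_ge0.
  - exact: emeasurable_funM.
by rewrite EFinM leeD2l// lee_wpmul2l// integral_sweep_kernel_le.
Qed.

End sweeping.

(** * The fractional integral *)

Section fracint.
Context {R : realType}.
Notation mu := (@lebesgue_measure R).
Implicit Types (a p s t r B : R) (phi psi : R -> R) (D : set R).

Definition fracint a phi t : R :=
  Rintegral mu `[0, t] (fun s => abel_kernel a t s * phi s).

Definition fracintegrable a phi t :=
  mu.-integrable `[0, t] (EFin \o (fun s => abel_kernel a t s * phi s)).

Lemma integral_abel_kernel_powR a p t : 0 < a -> -1 < p -> 0 < t ->
  (\int[mu]_(s in `]0%R, t[) (abel_kernel a t s * s `^ p)%:E =
   (Gamma (p + 1) / Gamma (p + 1 + a) * t `^ (p + a))%:E)%E.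
Proof.
move=> a0 p1 t0; have Ga0 := Gamma_gt0 a0.
have [p10 pa0] : 0 < p + 1 /\ 0 < p + 1 + a by split; lra.
transitivity (\int[mu]_(s in `]0%R, t[)
    ((Gamma a)^-1 * beta_density (p + 1) a t s)%:E)%E.
  apply: eq_integral => s _; congr EFin.
  by rewrite /abel_kernel /beta_density addrK; ring.
rewrite ge0_integral_EFinZl ?invr_ge0 ?(ltW Ga0)//; last 2 first.
- exact: measurable_beta_density.
- by move=> s _; exact: beta_density_ge0.
rewrite integral_beta// -EFinM (_ : p + 1 + a - 1 = p + a); last by ring.
by congr EFin; field; rewrite !gt_eqF// Gamma_gt0.
Qed.

Lemma powR_fracintegrable a p t : 0 < a -> -1 < p ->
  fracintegrable a (@powR R ^~ p) t.
Proof.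
move=> a0 p1.
have mk D : measurable_fun D (fun s => (abel_kernel a t s * s `^ p)%:E).
  apply/measurable_EFinP; apply: measurable_funM.
    exact: measurable_abel_kernel.
  by apply: measurable_funTS; exact: measurable_powR.
apply/integrableP; split; first exact: mk.
rewrite integral_itv_bndoo; last by apply: measurableT_comp => //; exact: mk.
rewrite [X in (X < _)%E](_ : _ =
    \int[mu]_(s in `]0%R, t[) (abel_kernel a t s * s `^ p)%:E)%E; last first.
  apply: eq_integral => s _.
  by rewrite /= ger0_norm// mulr_ge0 ?powR_ge0 ?abel_kernel_ge0.
have [t0|t0] := ltP 0 t; first by rewrite integral_abel_kernel_powR// ltry.
by rewrite set_itv_ge ?integral_set0// -leNgt bnd_simp.
Qed.

Lemma fracint0 a phi : fracint a phi 0 = 0.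
Proof. by rewrite /fracint set_itv1 Rintegral_set1. Qed.

Lemma fracint_powR a p t : 0 < a -> -1 < p -> 0 < p + a -> 0 <= t ->
  fracint a (@powR R ^~ p) t =
  Gamma (p + 1) / Gamma (p + 1 + a) * t `^ (p + a).
Proof.
move=> a0 p1 pa0; rewrite le_eqVlt => /predU1P[<-|t0].
  by rewrite fracint0 powR0 ?gt_eqF// mulr0.
apply: EFin_inj; rewrite EFin_Rintegral_itvoo; last exact: powR_fracintegrable.
exact: integral_abel_kernel_powR.
Qed.

Lemma integrable_abel_kernel a t : 0 < a ->
  mu.-integrable `[0, t] (EFin \o abel_kernel a t).
Proof.
move=> a0; apply: eq_integrable (powR_fracintegrable t a0 (ltrN10 _)) => //.
by move=> s _ /=; rewrite powRr0 mulr1.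
Qed.

Lemma integrable_abel_kernelM a t B phi D : 0 < a ->
  measurable D -> D `<=` `[0, t] -> measurable_fun D phi ->
  (forall s, D s -> `|phi s| <= B) ->
  mu.-integrable D (EFin \o (fun s => abel_kernel a t s * phi s)).
Proof.
move=> a0 mD Dt mphi phiB.
have ik : mu.-integrable D (EFin \o abel_kernel a t).
  exact: integrableS (integrable_abel_kernel t a0).
apply: le_integrable (integrableZl _ B ik) => //.
- apply/measurable_EFinP; apply: measurable_funM => //.
  exact: measurable_abel_kernel.
- move=> s /phiB sB; rewrite lee_fin !normrM mulrC ler_wpM2r//.
  by rewrite (le_trans sB)// ler_norm.
Qed.

Lemma bounded_fracintegrable a t B phi : 0 < a ->
  measurable_fun `[0, t] phi -> (forall s, 0 <= s <= t -> `|phi s| <= B) ->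
  fracintegrable a phi t.
Proof.
by move=> a0 mphi phiB; apply: (integrable_abel_kernelM (B := B)).
Qed.

Lemma continuous_fracintegrable a t phi : 0 < a ->
  {within `[0, t], continuous phi} -> fracintegrable a phi t.
Proof.
move=> a0 cphi; have [B phiB] := continuous_itv_bounded cphi.
apply: (bounded_fracintegrable (B := B)) => //.
exact: subspace_continuous_measurable_fun.
Qed.

Lemma fracintE a phi t : 0 < a -> fracintegrable a phi t ->
  fracint a phi t =
  (Gamma a)^-1 * Rintegral mu `[0, t] (fun s => (t - s) `^ (a - 1) * phi s).
Proof.
move=> a0 iphi; have Ga0 := Gamma_gt0 a0.
suff -> : Rintegral mu `[0, t] (fun s => (t - s) `^ (a - 1) * phi s) =
    Gamma a * fracint a phi t by rewrite mulKf ?gt_eqF.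
rewrite -RintegralZl//; apply: eq_Rintegral => s _.
by rewrite /abel_kernel; field; rewrite gt_eqF.
Qed.

Lemma eq_fracint a t phi psi : (forall s, 0 <= s <= t -> phi s = psi s) ->
  fracint a phi t = fracint a psi t.
Proof.
move=> eq_phi; apply: eq_Rintegral => s; rewrite inE/= in_itv/= => st.
by rewrite eq_phi.
Qed.

Lemma fracintZ a t (c : R) phi : fracintegrable a phi t ->
  fracint a (fun s => c * phi s) t = c * fracint a phi t.
Proof.
move=> iphi; rewrite -RintegralZl//.
by apply: eq_Rintegral => s _; rewrite mulrCA.
Qed.

Lemma fracintD a t phi psi : fracintegrable a phi t -> fracintegrable a psi t ->
  fracint a (fun s => phi s + psi s) t = fracint a phi t + fracint a psi t.
Proof.
move=> iphi ipsi; rewrite -RintegralD//.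
by apply: eq_Rintegral => s _; rewrite mulrDr.
Qed.

Lemma fracintB a t phi psi : fracintegrable a phi t -> fracintegrable a psi t ->
  fracint a (fun s => phi s - psi s) t = fracint a phi t - fracint a psi t.
Proof.
move=> iphi ipsi; rewrite -RintegralB//.
by apply: eq_Rintegral => s _; rewrite mulrBr.
Qed.

Lemma fracint_cvg a t B (phi_ : nat -> R -> R) phi : 0 < a ->
  (forall n, measurable_fun `[0, t] (phi_ n)) ->
  (forall n s, 0 <= s <= t -> `|phi_ n s| <= B) ->
  (forall s, 0 <= s <= t -> phi_ n s @[n --> \oo] --> phi s) ->
  fracint a (phi_ n) t @[n --> \oo] --> fracint a phi t.
Proof.
move=> a0 mphi_ phi_B phi_cvg.
pose f_ n s := (abel_kernel a t s * phi_ n s)%:E.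
pose f s := (abel_kernel a t s * phi s)%:E.
have mf_ n : measurable_fun `[0, t] (f_ n).
  apply/measurable_EFinP; apply: measurable_funM => //.
  exact: measurable_abel_kernel.
have f_f s : `[0, t]%classic s -> f_ n s @[n --> \oo] --> f s.
  rewrite /= in_itv/= => st; apply: cvg_EFin; first exact: nearW.
  by apply: cvgM; [exact: cvg_cst|exact: phi_cvg].
have mf : measurable_fun `[0, t] f by exact: emeasurable_fun_cvg f_f.
have iB : mu.-integrable `[0, t] (EFin \o (fun s => abel_kernel a t s * `|B|)).
  apply: (bounded_fracintegrable (phi := cst `|B|) (B := `|B|)) => // s _.
  by rewrite normr_id.
have [||if_ _ cvg_int] := @dominated_convergence _ _ _ mu `[0, t]
  (measurable_itv _) f_ f _ mf_ mf _ iB _.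
- exact: aeW.
- apply: aeW => s n; rewrite /= in_itv/= => st.
  rewrite lee_fin normrM ger0_norm ?abel_kernel_ge0//.
  rewrite ler_wpM2l ?abel_kernel_ge0//.
  by rewrite (le_trans (phi_B _ _ st))// ler_norm.
- by apply: fine_cvg; rewrite fineK//; exact: integrable_fin_num.
Qed.

End fracint.

Section minimum_principle.
Context {R : realType}.
Notation mu := (@lebesgue_measure R).
Implicit Types (a s t r B : R) (phi : R -> R).

(* Sweeping is available for nonnegative functions only: apply it to phi + B. *)
Lemma Rintegral_abel_kernel_sweep_ge a t0 t1 B N phi :
  0 < a < 1 -> 0 < t0 -> t0 < t1 ->
  measurable_fun `[0, t0] phi -> (forall s, 0 <= s <= t0 -> `|phi s| <= B) ->
  0 <= N -> (forall r, 0 < r < t0 -> - N <= fracint a phi r) ->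
  - (N * (t0 / t1) `^ (1 - a)) <=
    Rintegral mu `[0, t0] (fun s => abel_kernel a t1 s * phi s).
Proof.
move=> a01 t00 t01 mphi phiB N0 phiN; have /andP[a0 _] := a01.
have B0 : 0 <= B by apply: le_trans (phiB 0 _); rewrite ?normr_ge0 ?lexx ?ltW.
have ikM (h : R -> R) r t : measurable_fun `[0, t0] h ->
    (forall s, 0 <= s <= t0 -> `|h s| <= B) -> r <= t0 -> r <= t ->
    mu.-integrable `[0, r] (EFin \o (fun s => abel_kernel a t s * h s)).
  move=> mh hB rt0 rt; apply: (integrable_abel_kernelM (B := B)) => //.
  - by apply: subset_itvl; rewrite bnd_simp.
  - by apply: measurable_funS mh => //; apply: subset_itvl; rewrite bnd_simp.
  - move=> s; rewrite /= in_itv/= => /andP[s0 sr].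
    by rewrite hB// s0 (le_trans sr).
have ikphi r t := ikM phi r t mphi phiB.
have ikB r t : r <= t0 -> r <= t ->
    mu.-integrable `[0, r] (EFin \o (fun s => abel_kernel a t s * B)).
  by apply: (ikM (cst B)) => // s _; rewrite ger0_norm.
have integralDB r t : r <= t0 -> r <= t ->
    (\int[mu]_(s in `]0%R, r[) (abel_kernel a t s * (phi s + B))%:E =
     (Rintegral mu `[0%R, r] (fun s => abel_kernel a t s * phi s) +
      Rintegral mu `[0%R, r] (fun s => abel_kernel a t s * B))%:E)%E.
  move=> rt0 rt; have [ip iB] := (ikphi _ _ rt0 rt, ikB _ _ rt0 rt).
  rewrite -RintegralD// EFin_Rintegral_itvoo; last first.
    exact: eq_integrable (integrableD _ ip iB).
  by apply: eq_integral => s _; congr EFin; rewrite mulrDr.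
have : (\int[mu]_(s in `]0%R, t0[) (abel_kernel a t1 s * B)%:E <=
    \int[mu]_(s in `]0%R, t0[) (abel_kernel a t1 s * (phi s + B))%:E +
    (N * (t0 / t1) `^ (1 - a))%:E)%E.
  apply: (@integral_abel_kernel_sweep_le _ a t0 t1 a01 t00 t01 (cst B)) => //.
  - by apply: measurable_funD => //; apply: measurable_funS mphi => //;
      exact: subset_itv_oo_cc.
  - move=> s /andP[s0 st]; have : `|phi s| <= B by rewrite phiB// !ltW.
    by rewrite ler_norml => /andP[? _]; lra.
  - move=> r /andP[r0 rt0]; have rt0' := ltW rt0.
    rewrite integralDB// -EFin_Rintegral_itvoo; last exact: ikB.
    rewrite -EFinD lee_fin.
    have := phiN r; rewrite r0 rt0 => /(_ isT); rewrite /fracint; lra.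
have t01' := ltW t01.
rewrite integralDB// -EFin_Rintegral_itvoo; last exact: ikB.
by rewrite -EFinD lee_fin; lra.
Qed.

Lemma Rintegral_abel_kernel_le_fracint a t0 t1 phi :
  0 < a -> 0 <= t0 -> t0 <= t1 -> fracintegrable a phi t1 ->
  (forall s, t0 < s <= t1 -> 0 <= phi s) ->
  Rintegral mu `[0, t0] (fun s => abel_kernel a t1 s * phi s) <=
    fracint a phi t1.
Proof.
move=> a0 t00 t01 iphi phi0.
have itv01 : `[0, t1]%classic = `[0, t0]%classic `|` `]t0, t1]%classic :> set R.
  by rewrite -itv_bndbnd_setU// bnd_simp.
rewrite /fracint itv01 Rintegral_setU//; last 2 first.
- by rewrite -itv01.
- apply/disj_setPS => x [/=]; rewrite !in_itv/= => /andP[_ xt0] /andP[].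
  by rewrite ltNge xt0.
rewrite lerDl; apply: Rintegral_ge0 => s /=; rewrite in_itv/= => st.
by rewrite mulr_ge0 ?abel_kernel_ge0 ?phi0.
Qed.

Lemma fracint_minimum_at_end_ge0 a t1 B y0 (y phi : R -> R) :
  0 < a < 1 -> 0 <= t1 -> 0 <= y0 -> {within `[0, t1], continuous y} ->
  measurable_fun `[0, t1] phi -> (forall t, 0 <= t <= t1 -> `|phi t| <= B) ->
  (forall t, 0 <= t <= t1 -> y t = y0 + fracint a phi t) ->
  (forall t, 0 <= t <= t1 -> y t < 0 -> 0 <= phi t) ->
  (forall t, 0 <= t <= t1 -> y t1 <= y t) -> 0 <= y t1.
Proof.
move=> a01 t1_ge0 y00 cy mphi phiB yE phi0 ymin; have /andP[a0 a1] := a01.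
have t1t1 : 0 <= t1 <= t1 by rewrite t1_ge0 lexx.
rewrite leNgt; apply/negP => yt1.
have t1_gt0 : 0 < t1.
  rewrite lt_neqAle t1_ge0 andbT; apply/eqP => t10.
  by move: yt1; rewrite -t10 yE -?t10 ?lexx// fracint0 addr0 ltNge y00.
have [t0 /andP[t00 t01] yneg] : exists2 t0, 0 < t0 < t1 &
    forall s, t0 <= s <= t1 -> y s < 0.
  by apply: (continuous_itv_lt_left cy) => //; rewrite t1_gt0 lexx.
have sub01 : `[0, t0] `<=` `[0, t1] by apply: subset_itvl; rewrite bnd_simp ltW.
have N0 : 0 < y0 - y t1 by rewrite subr_gt0 (lt_le_trans yt1).
have past : - ((y0 - y t1) * (t0 / t1) `^ (1 - a)) <=
    Rintegral mu `[0, t0] (fun s => abel_kernel a t1 s * phi s).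
  apply: (Rintegral_abel_kernel_sweep_ge (B := B)) => //.
  - exact: measurable_funS mphi.
  - by move=> s st; apply: phiB; exact: sub01.
  - exact: ltW.
  - move=> r /andP[r0 rt0].
    have rt1 : 0 <= r <= t1 by rewrite (ltW r0) ltW// (lt_trans rt0).
    by have := ymin _ rt1; rewrite (yE r)//; lra.
have future : Rintegral mu `[0, t0] (fun s => abel_kernel a t1 s * phi s) <=
    fracint a phi t1.
  apply: Rintegral_abel_kernel_le_fracint => //; rewrite ?ltW//.
    exact: (bounded_fracintegrable (B := B)).
  move=> s /andP[ts st]; have s0 := lt_trans t00 ts.
  by apply: phi0; [rewrite (ltW s0)|apply: yneg; rewrite (ltW ts)].
have sweep_lt1 : (t0 / t1) `^ (1 - a) < 1 `^ (1 - a).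
  apply: gt0_ltr_powR; rewrite ?nnegrE ?subr_gt0// ?divr_ge0 ?ltW//.
  by rewrite ltr_pdivrMr// mul1r.
have := yE _ t1t1.
by move: sweep_lt1; rewrite powR1 -(ltr_pM2l N0) mulr1; lra.
Qed.

Lemma fracint_minimum_principle a T B y0 (y phi : R -> R) :
  0 < a < 1 -> 0 <= y0 -> {within `[0, T], continuous y} ->
  measurable_fun `[0, T] phi -> (forall t, 0 <= t <= T -> `|phi t| <= B) ->
  (forall t, 0 <= t <= T -> y t = y0 + fracint a phi t) ->
  (forall t, 0 <= t <= T -> y t < 0 -> 0 <= phi t) ->
  forall t, 0 <= t <= T -> 0 <= y t.
Proof.
move=> a01 y00 cy mphi phiB yE phi0 t tT.
have T0 : 0 <= T by case/andP: tT => /le_trans; apply.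
have [t1 + ymin] := EVT_min T0 cy; rewrite in_itv/= => /andP[t1_ge0 t1T].
have sub1T : `[0, t1] `<=` `[0, T] by apply: subset_itvl; rewrite bnd_simp.
apply: (@le_trans _ _ (y t1)); last by apply: ymin; rewrite in_itv.
apply: (fracint_minimum_at_end_ge0 (B := B) a01 t1_ge0 y00 (phi := phi)).
- exact: continuous_subspaceW cy.
- exact: measurable_funS mphi.
- by move=> s /sub1T; exact: phiB.
- by move=> s /sub1T; exact: yE.
- by move=> s /sub1T; exact: phi0.
- by move=> s /sub1T; exact: ymin.
Qed.

End minimum_principle.

(** * The Mittag-Leffler function *)

Section entire_pseries.
Context {R : realType}.
Implicit Types (c u : nat -> R) (x K q : R).

Lemma is_cvg_series_le_geometric u K q : 0 <= q < 1 ->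
  (forall k, `|u k| <= K * q ^+ k) -> cvgn (series u).
Proof.
move=> /andP[q0 q1] uK; apply: normed_cvg.
have K0 : 0 <= K by have := le_trans (normr_ge0 _) (uK 0); rewrite expr0 mulr1.
rewrite /normed_series_of/=; apply: (@series_le_cvg _ _ (geometric K q)) => //.
- by move=> n; rewrite /geometric/= mulr_ge0// exprn_ge0.
- by apply: is_cvg_geometric_series; rewrite ger0_norm.
Qed.

Lemma is_cvg_pseries_diffs c : (forall x, cvgn (pseries c x)) ->
  forall x, cvgn (pseries (pseries_diffs c) x).
Proof.
move=> cvg_c x; pose w := `|x| + 1.
have w0 : 0 <= w by rewrite addr_ge0.
have [K K0 cK] : exists2 K, 0 < K & forall k, `|c k * (4 * w) ^+ k| <= K.
  have /pinfty_ex_gt0[K K0 cK] := cvg_series_bounded (cvg_c (4 * w)).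
  by exists K => // k; exact: cK.
apply: (@is_cvg_series_le_geometric _ K 2^-1); first by apply/andP; split; lra.
move=> k; apply: (@le_trans _ _ (K * 2^-1 ^+ k.+1)); last first.
  rewrite ler_pM2l// exprS ler_piMl ?exprn_ge0//; lra.
apply: (@le_trans _ _ (2 ^+ k.+1 * `|c k.+1| * w ^+ k.+1)).
  rewrite /pseries_diffs !normrM normr_nat normrX.
  apply: ler_pM; rewrite ?mulr_ge0 ?exprn_ge0//.
    by rewrite ler_wpM2r// -natrX ler_nat ltnW// ltn_expl.
  apply: (@le_trans _ _ (w ^+ k)); first by rewrite lerXn2r ?nnegrE// lerDl.
  by rewrite exprS ler_peMl ?exprn_ge0// lerDr.
have -> : 2 ^+ k.+1 * `|c k.+1| * w ^+ k.+1 =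
    `|c k.+1 * (4 * w) ^+ k.+1| * 2^-1 ^+ k.+1.
  rewrite normrM (ger0_norm (exprn_ge0 _ _)) ?mulr_ge0//.
  rewrite (_ : 4 * w = 2 * (2 * w)); last by ring.
  rewrite !exprMn exprVn; set p := 2 ^+ k.+1; field.
  by rewrite expf_neq0.
by rewrite ler_wpM2r ?exprn_ge0.
Qed.

Lemma continuous_limn_pseries c : (forall x, cvgn (pseries c x)) ->
  continuous (fun x => limn (pseries c x)).
Proof.
move=> cvg_c x; apply: differentiable_continuous; apply/derivable1_diffP.
have cvg_dc := is_cvg_pseries_diffs cvg_c.
have cvg_ddc := is_cvg_pseries_diffs cvg_dc.
have x_lt : `|x| < `| `|x| + 1| by rewrite [ltRHS]ger0_norm ?ltrDl ?addr_ge0.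
by have [] := pseries_snd_diffs (cvg_c _) (cvg_dc _) (cvg_ddc _) x_lt.
Qed.

Lemma pseriesS c x n : pseries c x n.+1 = pseries c x n + c n * x ^+ n.
Proof. by rewrite /pseries seriesSr. Qed.

Lemma continuous_pseries c n : continuous (pseries c ^~ n).
Proof.
elim: n => [|n IHn].
  rewrite (_ : pseries c ^~ 0%N = cst 0); first exact: cst_continuous.
  by apply/funext => x; rewrite /pseries /series/= big_geq.
rewrite (_ : pseries c ^~ n.+1 = (fun x => pseries c x n + c n * x ^+ n)).
  move=> x; apply: cvgD; first exact: IHn.
  by apply: cvgM; [exact: cvg_cst|exact: exprn_continuous].
by apply/funext => x; exact: pseriesS.
Qed.

End entire_pseries.

Section mittag_leffler_series.
Context {R : realType}.
Implicit Types (a x y z rho : R) (k n : nat).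

Definition mlcoef a k : R := (Gamma (a * k%:R + 1))^-1.

Lemma mittag_lefflerE a z : mittag_leffler a z = limn (pseries (mlcoef a) z).
Proof.
rewrite /mittag_leffler /pseries /series/=; congr (limn _); apply/funext => n.
by apply: eq_bigr => k _; rewrite mulrC.
Qed.

Let index_gt0 a k : 0 < a -> 0 < a * k%:R + 1.
Proof. by move=> a0; rewrite ltr_wpDl// mulr_ge0// ltW. Qed.

Lemma mlcoef_gt0 a k : 0 < a -> 0 < mlcoef a k.
Proof. by move=> a0; rewrite invr_gt0 Gamma_gt0// index_gt0. Qed.

Lemma mlcoef_le_geometric a rho : 0 < a -> 0 < rho ->
  exists K, forall k, mlcoef a k <= K * rho ^+ k.
Proof.
move=> a0 rho0; pose c := rho `^ (- a^-1).
have c0 : 0 < c by rewrite powR_gt0.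
pose d := c * (expR (- (c + 1)) / (c + 1)).
have d0 : 0 < d by rewrite mulr_gt0 ?divr_gt0 ?expR_gt0// addr_gt0.
exists d^-1 => k.
have -> : d^-1 * rho ^+ k = (rho ^- k * d)^-1 by rewrite [RHS]invfM invrK mulrC.
have rhod0 : 0 < rho ^- k * d by rewrite (mulr_gt0 _ d0)// invr_gt0 exprn_gt0.
rewrite lef_pV2 ?posrE ?Gamma_gt0 ?index_gt0//.
apply: le_trans (powR_le_Gamma (index_gt0 k a0) c0).
rewrite powRD ?(gt_eqF c0) ?implybT// powRr1 ?(ltW c0)// mulrA.
rewrite [c `^ (a * _)](_ : _ = rho ^- k) ?mulrA//.
by rewrite /c -powRrM mulNr mulKf ?gt_eqF// powRN powR_mulrn ?ltW.
Qed.

Lemma is_cvg_pseries_mlcoef a z : 0 < a -> cvgn (pseries (mlcoef a) z).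
Proof.
move=> a0; pose w := `|z| + 1; have w0 : 0 < w by rewrite ltr_wpDl.
have rho0 : 0 < (2 * w)^-1 by rewrite invr_gt0 mulr_gt0.
have [K coefK] := mlcoef_le_geometric a0 rho0.
apply: (@is_cvg_series_le_geometric _ _ K 2^-1).
  by apply/andP; split; lra.
move=> k; rewrite normrM normrX gtr0_norm ?mlcoef_gt0//.
apply: (@le_trans _ _ (K * (2 * w)^-1 ^+ k * w ^+ k)); last first.
  by rewrite -mulrA -exprMn invfM -mulrA mulVf ?gt_eqF// mulr1.
apply: ler_pM; rewrite ?exprn_ge0 ?(ltW (mlcoef_gt0 _ _))//.
by rewrite lerXn2r ?nnegrE ?(ltW w0)// lerDl.
Qed.

Lemma continuous_mittag_leffler a : 0 < a -> continuous (mittag_leffler a).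
Proof.
move=> a0.
rewrite (_ : mittag_leffler a = fun z => limn (pseries (mlcoef a) z)).
  by apply: continuous_limn_pseries => z; exact: is_cvg_pseries_mlcoef.
by apply/funext => z; exact: mittag_lefflerE.
Qed.

Lemma cvg_mittag_leffler a z : 0 < a ->
  pseries (mlcoef a) z n @[n --> \oo] --> mittag_leffler a z.
Proof. by move=> a0; rewrite mittag_lefflerE; exact: is_cvg_pseries_mlcoef. Qed.

Lemma norm_pseries_mlcoef_le a y z n : 0 < a -> `|z| <= y ->
  `|pseries (mlcoef a) z n| <= mittag_leffler a y.
Proof.
move=> a0 zy; have y0 : 0 <= y by exact: le_trans zy.
apply: (@le_trans _ _ (pseries (mlcoef a) y n)).
  rewrite /pseries /series/=; apply: (le_trans (ler_norm_sum _ _ _)).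
  apply: ler_sum => k _; rewrite normrM normrX gtr0_norm ?mlcoef_gt0//.
  by rewrite ler_pM2l ?mlcoef_gt0// lerXn2r ?nnegrE.
rewrite mittag_lefflerE; apply: nondecreasing_cvgn_le.
  apply: nondecreasing_series => k _ _.
  by rewrite mulr_ge0 ?exprn_ge0// ltW// mlcoef_gt0.
exact: is_cvg_pseries_mlcoef.
Qed.

End mittag_leffler_series.

Section fracint_mittag_leffler.
Context {R : realType}.
Implicit Types (a t lambda : R).

Section picard.
Variables a lambda : R.
Hypothesis a_gt0 : 0 < a.

Let S n s := pseries (mlcoef a) (lambda * s `^ a) n.

Let S_within n t : {within `[0, t], continuous (S n)}.
Proof.
apply: (@within_continuous_comp_powR _ _ _ _ (pseries (mlcoef a) ^~ n)) => //.
exact: continuous_pseries.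
Qed.

Let monomial k s := mlcoef a k * (lambda * s `^ a) ^+ k.

Let monomialE k s : monomial k s = mlcoef a k * lambda ^+ k * s `^ (a * k%:R).
Proof. by rewrite /monomial exprMn mulrA powRrM powR_mulrn ?powR_ge0. Qed.

Let monomial_fracintegrable k t : fracintegrable a (monomial k) t.
Proof.
apply: continuous_fracintegrable => //.
pose h x := mlcoef a k * x ^+ k.
apply: (@within_continuous_comp_powR _ _ _ _ h) => //.
by move=> x; apply: cvgM; [exact: cvg_cst|exact: exprn_continuous].
Qed.

Let fracint_monomial k t : 0 <= t ->
  lambda * fracint a (monomial k) t = monomial k.+1 t.
Proof.
move=> t0; have ak0 : 0 <= a * k%:R by rewrite mulr_ge0// ltW.
have ak1 : -1 < a * k%:R by rewrite (lt_le_trans (ltrN10 _)).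
rewrite (@eq_fracint _ a t _
    (fun s => mlcoef a k * lambda ^+ k * s `^ (a * k%:R))).
  rewrite fracintZ; last exact: powR_fracintegrable.
  rewrite fracint_powR//; last by rewrite ltr_wpDl.
  rewrite monomialE /mlcoef exprS -natr1 mulrDr mulr1 addrAC.
  have [G0 G1] : 0 < Gamma (a * k%:R + 1) /\ 0 < Gamma (a * k%:R + a + 1).
    by split; apply: Gamma_gt0; move: a_gt0 ak0; lra.
  by field; rewrite !gt_eqF.
by move=> s _; exact: monomialE.
Qed.

Lemma pseries_mlcoef_picard n t : 0 <= t ->
  pseries (mlcoef a) (lambda * t `^ a) n.+1 =
  1 + lambda * fracint a (fun s => pseries (mlcoef a) (lambda * s `^ a) n) t.
Proof.
move=> t0; elim: n => [|n IHn].
  have pseries0 z : pseries (mlcoef a) z 0 = 0.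
    by rewrite /pseries /series/= big_geq.
  rewrite pseriesS pseries0 add0r expr0 mulr1 /mlcoef mulr0 add0r Gamma1 invr1.
  rewrite /fracint /Rintegral integral0_eq ?mulr0 ?addr0// => s _.
  by rewrite pseries0 mulr0.
rewrite pseriesS IHn -[X in _ + X]fracint_monomial// -addrA -mulrDr -fracintD//.
- by congr (1 + _ * _); apply: eq_fracint => s _; rewrite pseriesS.
- by apply: continuous_fracintegrable => //; exact: S_within.
Qed.

(* The partial sums are the Picard iterates of the equation. *)
Lemma mittag_leffler_fracint t : 0 <= t ->
  mittag_leffler a (lambda * t `^ a) =
  1 + lambda * fracint a (fun s => mittag_leffler a (lambda * s `^ a)) t.
Proof.
move=> t0.
have picard_cvg : 1 + lambda * fracint a (S n) t @[n --> \oo] -->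
    mittag_leffler a (lambda * t `^ a).
  rewrite (_ : (fun n => _) =
      (fun n => pseries (mlcoef a) (lambda * t `^ a) n.+1)).
    by rewrite (cvg_shiftS (pseries _ _)); exact: cvg_mittag_leffler.
  by apply/funext => n; rewrite pseries_mlcoef_picard.
apply: cvg_unique picard_cvg _ => //.
apply: cvgD; first exact: cvg_cst.
apply: cvgM; first exact: cvg_cst.
apply: (fracint_cvg (B := mittag_leffler a (`|lambda| * t `^ a))) => //.
- by move=> n; apply: subspace_continuous_measurable_fun => //; exact: S_within.
- move=> n s /andP[s0 st]; apply: norm_pseries_mlcoef_le => //.
  rewrite normrM ler_wpM2l// ger0_norm ?powR_ge0//.
  by apply: ge0_ler_powR; rewrite ?nnegrE ?(ltW a_gt0).
- by move=> s _; exact: cvg_mittag_leffler.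
Qed.

End picard.

Lemma within_continuous_mittag_leffler a lambda t : 0 < a ->
  {within `[0, t], continuous (fun s => mittag_leffler a (lambda * s `^ a))}.
Proof.
move=> a0.
apply: (@within_continuous_comp_powR _ _ _ _ (mittag_leffler a)) => //.
exact: continuous_mittag_leffler.
Qed.

End fracint_mittag_leffler.

(** * Comparison with the Mittag-Leffler function *)

Section comparison.
Context {R : realType}.
Implicit Types (a t x y M T lambda : R) (z g : R -> R).

Lemma mittag_leffler_ge0 a x : 0 < a < 1 -> 0 <= mittag_leffler a x.
Proof.
move=> a01; have /andP[a0 _] := a01.
have [x0|x0] := leP 0 x.
  apply: le_trans (@norm_pseries_mlcoef_le _ a x x 0 a0 _) => //.
  by rewrite ger0_norm.
pose u s := mittag_leffler a (x * s `^ a).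
have cu : {within `[0, 1], continuous u}.
  exact: within_continuous_mittag_leffler.
have cxu : {within `[0, 1], continuous (fun s => x * u s)}.
  exact: within_continuousZ.
have [B xuB] := continuous_itv_bounded cxu.
have -> : mittag_leffler a x = u 1 by rewrite /u powR1 mulr1.
apply: (fracint_minimum_principle a01 ler01 cu _ xuB); rewrite ?ler01 ?lexx//.
- exact: subspace_continuous_measurable_fun.
- move=> t /andP[t0 t1]; rewrite fracintZ; first exact: mittag_leffler_fracint.
  apply: continuous_fracintegrable => //.
  exact: within_continuous_itv_le cu.
- by move=> t _ ut0; rewrite mulr_le0 ?ltW.
Qed.

Lemma mittag_leffler_le_fracint a lambda T y0 z g :
  0 < a < 1 -> lambda <= 0 ->
  {within `[0, T], continuous z} -> {within `[0, T], continuous g} ->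
  (forall t, 0 <= t <= T -> z t = y0 + fracint a g t) ->
  (forall t, 0 <= t <= T -> lambda * z t <= g t) ->
  forall t, 0 <= t <= T -> y0 * mittag_leffler a (lambda * t `^ a) <= z t.
Proof.
move=> a01 l0 cz cg zE zg; have /andP[a0 _] := a01.
pose u s := mittag_leffler a (lambda * s `^ a).
have cu : {within `[0, T], continuous u}.
  exact: within_continuous_mittag_leffler.
have clu : {within `[0, T], continuous (fun s => lambda * u s)}.
  exact: within_continuousZ.
have cphi : {within `[0, T], continuous (fun s => g s - y0 * (lambda * u s))}.
  by apply: within_continuousB => //; exact: within_continuousZ.
have int (h : R -> R) t :
    {within `[0, T], continuous h} -> t <= T -> fracintegrable a h t.
  move=> ch tT; apply: continuous_fracintegrable => //.
  exact: within_continuous_itv_le ch.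
have [B phiB] := continuous_itv_bounded cphi.
move=> t tT; rewrite -subr_ge0.
apply: (fracint_minimum_principle (y := fun s => z s - y0 * u s)
  a01 (lexx 0) _ _ phiB) tT.
- by apply: within_continuousB => //; exact: within_continuousZ.
- exact: subspace_continuous_measurable_fun.
- move=> s sT; have /andP[s0 leT] := sT.
  rewrite zE// fracintB ?fracintZ//; do ?[exact: int];
    last by apply: int => //; exact: within_continuousZ.
  by rewrite {1}/u mittag_leffler_fracint// /u; ring.
- move=> s sT zu; rewrite subr_ge0; apply: le_trans (zg _ sT).
  by rewrite mulrCA ler_wnM2l// -subr_le0 ltW.
Qed.

Lemma mittag_leffler_nondecreasing a : 0 < a < 1 ->
  {in `]-oo, 0] &, {homo mittag_leffler a : x y / x <= y}}.
Proof.
move=> a01 x y /[!in_itv]/= x0 _ xy; have /andP[a0 _] := a01.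
pose u s := mittag_leffler a (y * s `^ a).
have cu : {within `[0, 1], continuous u}.
  exact: within_continuous_mittag_leffler.
have := @mittag_leffler_le_fracint a x 1 1 u (fun s => y * u s) a01 x0 cu.
have cyu : {within `[0, 1], continuous (fun s => y * u s)}.
  exact: within_continuousZ.
move=> /(_ cyu _ _ 1); rewrite /u powR1 mul1r !mulr1 ler01 lexx; apply => //.
- move=> t /andP[t0 t1]; rewrite fracintZ; first exact: mittag_leffler_fracint.
  apply: continuous_fracintegrable => //.
  exact: within_continuous_itv_le cu.
- by move=> t _; rewrite ler_wpM2r// mittag_leffler_ge0.
Qed.

Lemma mittag_leffler_le_norm_fracint a M T y0 z g :
  0 < a < 1 -> 0 <= M -> 0 <= T -> 0 <= y0 ->
  {within `[0, T], continuous z} -> {within `[0, T], continuous g} ->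
  (forall t, 0 <= t <= T -> z t = y0 + fracint a g t) ->
  (forall t, 0 <= t <= T -> `|g t| <= M * `|z t|) ->
  y0 * mittag_leffler a (- (M * T `^ a)) <= `|z T|.
Proof.
move=> a01 M0 T0; rewrite le_eqVlt => /predU1P[<- *|y00].
  by rewrite mul0r.
move=> cz cg zE gM; have /andP[a0 _] := a01.
have lower t : 0 <= t <= T -> (forall s, 0 <= s <= t -> 0 <= z s) ->
    y0 * mittag_leffler a (- (M * t `^ a)) <= z t.
  move=> /andP[t0 tT] z_ge0.
  have sub : `[0, t] `<=` `[0, T] by apply: subset_itvl; rewrite bnd_simp.
  rewrite -mulNr; apply: (@mittag_leffler_le_fracint a (- M) t y0 z g) => //.
  - by rewrite oppr_le0.
  - exact: continuous_subspaceW cz.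
  - exact: continuous_subspaceW cg.
  - by move=> s /sub; exact: zE.
  - move=> s st; have := gM _ (sub _ st).
    by rewrite (ger0_norm (z_ge0 _ st)) mulNr ler_norml => /andP[].
  - by rewrite t0 lexx.
have [z_ge0|] := pselect (forall s, 0 <= s <= T -> 0 <= z s).
  by apply: le_trans (ler_norm _); apply: lower => //; rewrite T0 lexx.
move=> /existsNP[s /not_implyP[sT /negP]]; rewrite -ltNge => /ltW zs.
have z0 : 0 <= z 0 by rewrite zE ?lexx// fracint0 addr0 ltW.
have [t /andP[t0 ts] [zt z_ge0]] := continuous_itv_first_zero cz z0 sT zs.
have tT : t <= T by case/andP: sT => _; exact: le_trans.
have Mt0 r : - (M * r `^ a) <= 0 by rewrite oppr_le0 mulr_ge0 ?powR_ge0.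
have := lower t; rewrite t0 tT zt => /(_ isT z_ge0); rewrite pmulr_rle0// => Et.
apply: (@le_trans _ _ 0) => //; rewrite pmulr_rle0//; apply: le_trans Et.
apply: mittag_leffler_nondecreasing; rewrite ?in_itv//= lerN2 ler_wpM2l//.
by apply: ge0_ler_powR; rewrite ?nnegrE ?(ltW a0).
Qed.

End comparison.

Section caputo.
Context {R : realType}.
Implicit Types (a t : R) (J : set R) (f : R -> R -> R) (x L : R -> R).

Lemma caputo_solution_fracint a J f x t : 0 < a -> `[0, t] `<=` J ->
  {within J, continuous (fun s => f s (x s))} -> caputo_solution a J f x ->
  forall s, 0 <= s <= t -> x s = x 0 + fracint a (fun r => f r (x r)) s.
Proof.
move=> a0 tJ cfx [_ xE] s st; rewrite xE; last exact: tJ.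
rewrite fracintE//; apply: continuous_fracintegrable => //.
apply: continuous_subspaceW cfx; apply: subset_trans tJ.
by apply: subset_itvl; rewrite bnd_simp; case/andP: st.
Qed.

Lemma caputo_solution_gap_ge a J f L x1 x2 t :
  0 < a < 1 -> 0 <= t -> `[0, t] `<=` J ->
  {within [set p : R * R | J p.1], continuous (fun p => f p.1 p.2)} ->
  {within J, continuous L} ->
  (forall s, J s -> 0 <= L s) ->
  (forall s, J s -> forall u v : R, `|f s u - f s v| <= L s * `|u - v|) ->
  caputo_solution a J f x1 -> caputo_solution a J f x2 -> x1 0 <= x2 0 ->
  (x2 0 - x1 0) * mittag_leffler a (- (sup (L @` `[0, t]) * t `^ a))
    <= `|x2 t - x1 t|.
Proof.
move=> a01 t0 tJ cf cL L0 lip sol1 sol2 x12; have /andP[a0 _] := a01.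
have cLt := continuous_subspaceW tJ cL.
have LleM s : 0 <= s <= t -> L s <= sup (L @` `[0, t]).
  exact: continuous_itv_le_sup.
have M0 : 0 <= sup (L @` `[0, t]).
  have J0 : J 0 by apply: tJ; rewrite /= in_itv/= lexx.
  by apply: le_trans (LleM 0 _); rewrite ?L0 ?lexx.
have [[cx1 _] [cx2 _]] := (sol1, sol2).
have cf1 := within_continuous_graph cf cx1.
have cf2 := within_continuous_graph cf cx2.
have cB (h k : R -> R) : {within J, continuous h} -> {within J, continuous k} ->
    {within `[0, t], continuous (fun s => h s - k s)}.
  move=> ch ck; apply: (continuous_subspaceW tJ).
  exact: within_continuousB ch ck.
have int (h : R -> R) s :
    {within J, continuous h} -> s <= t -> fracintegrable a h s.
  move=> ch st; apply: continuous_fracintegrable => //.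
  by apply: within_continuous_itv_le st _; exact: continuous_subspaceW ch.
apply: (@mittag_leffler_le_norm_fracint _ a _ t (x2 0 - x1 0)
  (fun s => x2 s - x1 s) (fun s => f s (x2 s) - f s (x1 s))) => //.
- by rewrite subr_ge0.
- exact: cB.
- exact: cB.
- move=> s st; have /andP[_ le_st] := st.
  rewrite fracintB; [|exact: int|exact: int].
  by rewrite (caputo_solution_fracint a0 tJ cf2 sol2 st)
    (caputo_solution_fracint a0 tJ cf1 sol1 st); ring.
- move=> s st; have Js : J s by apply: tJ; rewrite /= in_itv.
  apply: le_trans (lip _ Js _ _) _.
  by rewrite ler_wpM2r ?LleM.
Qed.

End caputo.

Theorem mainTheorem2 (R : realType) (a : R) (J : set R)
    (f : R -> R -> R) (L : R -> R) (x1 x2 : R -> R) :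
  0 < a < 1 ->
  ((exists T : R, 0 < T /\ J = [set` `[0, T]]) \/ J = [set` `[0, +oo[]) ->
  {within [set p : R * R | J p.1], continuous (fun p => f p.1 p.2)} ->
  {within J, continuous L} ->
  (forall t, J t -> 0 <= L t) ->
  (forall t, J t -> forall u v : R, `|f t u - f t v| <= L t * `|u - v|) ->
  caputo_solution a J f x1 ->
  caputo_solution a J f x2 ->
  forall t, J t ->
    `|x2 0 - x1 0| * mittag_leffler a (- (sup (L @` `[0, t]) * t `^ a))
      <= `|x2 t - x1 t|.
Proof.
move=> a01 JE cf cL L0 lip sol1 sol2 t Jt.
have [t0 tJ] : 0 <= t /\ `[0, t] `<=` J.
  case: JE Jt => [[T [_ ->]]|->] /=; rewrite in_itv/=.
    by move=> /andP[t0 tT]; split => //; exact: subset_itvl.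
  by rewrite andbT => t0; split => //; exact: subset_itvl.
wlog x12 : x1 x2 sol1 sol2 / x1 0 <= x2 0 => [gap_ge|].
  have [|/ltW x21] := leP (x1 0) (x2 0); first exact: gap_ge.
  by rewrite distrC [leRHS]distrC; exact: gap_ge.
rewrite ger0_norm ?subr_ge0//.
exact: (caputo_solution_gap_ge (J := J) (f := f)).
Qed.
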